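(* For all $\varepsilon>0$ and every positive integer $k$, there exists $D_0$ such that the following holds for all $D\ge D_0$ and all $b\in(0,1)$. Let $\mathcal{H}$ be a $k$-uniform hypergraph with maximum degree at most $D$. If for every real number $D'\ge \varepsilon D/3$ and every sub-hypergraph $H\subseteq\mathcal{H}$ with maximum degree $\Delta(H)\le D'$ we have $$b_{L(H),\,kD'}(e)\le b \quad\text{for all } e\in E(H),$$ then $$\chi'(\mathcal{H})\le (b+\varepsilon)kD.$$
   Context: A hypergraph $\mathcal{H}$ consists of a vertex set $V(\mathcal{H})$ and a multiset $E(\mathcal{H})$ of edges, each a subset of $V(\mathcal{H})$ (repeated edges are allowed and copies count as distinct edges). It is $k$-uniform if every edge has size $k$. The degree of a vertex is the number of edges (with multiplicity) containing it, and $\Delta$ denotes maximum degree. The chromatic index $\chi'(\mathcal{H})$ is the smallest number of colors needed to color the edges so that any two distinct intersecting edges receive distinct colors. The line graph $L(\mathcal{H})$ is the simple graph whose vertices are the edges of $\mathcal{H}$ (with multiplicity), two distinct edges being adjacent iff they intersect. For a graph $G$ and $v\in V(G)$, let $P_G(v):=\binom{\deg_G(v)}{2}-|E(N_G(v))|$ be the number of non-adjacent (unordered) pairs of distinct vertices in $N_G(v)$, where $E(N_G(v))$ is the set of edges of $G$ with both ends in $N_G(v)$, and let $T_G(v)$ be the number of $3$-element subsets of $N_G(v)$ that are pairwise non-adjacent in $G$. For a number $M\ge\Delta(G)$, define $$b_{G,M}(v):=\frac{\deg_G(v)}{M}-\frac{P_G(v)}{M^2}+\frac{T_G(v)}{M^3}.$$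 *)

(* Defs.v *)
From mathcomp Require Import all_boot all_order all_algebra.
From mathcomp Require Import reals.

Set Implicit Arguments.
Unset Strict Implicit.
Unset Printing Implicit Defensive.

Import Order.TTheory GRing.Theory Num.Theory.

(* A finite hypergraph whose edges are labelled by elements of [I]: distinct
   labels may carry the same vertex set, which encodes the multiset of edges.
   [ends e] is meaningful only for [e \in hedges]. *)
Record hypergraph (T I : finType) := Hypergraph {
  hverts : {set T};
  hedges : {set I};
  ends : I -> {set T};
  ends_sub : forall e, e \in hedges -> ends e \subset hverts
}.

Record sgraph (I : finType) := SGraph {
  gverts : {set I};
  adj : rel I;
  adj_sym : symmetric adj;
  adj_irr : irreflexive adj;
  adj_verts : forall u v, adj u v -> u \in gverts
}.

Section Hypergraphs.
Variables T I : finType.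
Implicit Types H K : hypergraph T I.

Definition uniform (k : nat) H : bool :=
  [forall e in hedges H, #|ends H e| == k].

Definition hdegree H (v : T) : nat := #|[set e in hedges H | v \in ends H e]|.

Definition max_hdegree H : nat := \max_(v in hverts H) hdegree H v.

Definition subhypergraph K H : bool :=
  [&& hverts K \subset hverts H, hedges K \subset hedges H
    & [forall e in hedges K, ends K e == ends H e]].

Definition intersecting H (e f : I) : bool := ends H e :&: ends H f != set0.

(* Colorings are defined on the subtype of actual edges, so that a hypergraph
   without edges is 0-colorable even when [I] is inhabited. *)
Definition edge_colorable H (n : nat) : bool :=
  [exists c : {ffun {e : I | e \in hedges H} -> 'I_n},
    forall e, forall f,
      (e != f) && intersecting H (val e) (val f) ==> (c e != c f)].

Lemma edge_colorable_exists H : exists n, edge_colorable H n.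
Proof.
exists #|{: {e : I | e \in hedges H}}|.
apply/existsP; exists [ffun e => enum_rank e].
apply/forallP => e; apply/forallP => f; apply/implyP => /andP[nef _].
by rewrite !ffunE (inj_eq enum_rank_inj).
Qed.

Definition chromatic_index H : nat := ex_minn (edge_colorable_exists H).

Definition line_adj H : rel I := fun e f =>
  [&& e \in hedges H, f \in hedges H, e != f & intersecting H e f].

Lemma line_adj_sym H : symmetric (line_adj H).
Proof.
by move=> e f; rewrite /line_adj /intersecting setIC eq_sym andbCA.
Qed.

Lemma line_adj_irr H : irreflexive (line_adj H).
Proof. by move=> e; rewrite /line_adj eqxx !andbF. Qed.

Lemma line_adj_verts H e f : line_adj H e f -> e \in hedges H.
Proof. by case/and4P. Qed.

Definition line_graph H : sgraph I :=
  SGraph (@line_adj_sym H) (@line_adj_irr H) (@line_adj_verts H).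

End Hypergraphs.

Section LocalCounts.
Variables (I : finType) (G : sgraph I).

Definition nbhd (v : I) : {set I} := [set u in gverts G | adj G v u].

Definition gdegree (v : I) : nat := #|nbhd v|.

Definition edges_within (S : {set I}) : {set {set I}} :=
  [set [set u; w] | u in S, w in S & adj G u w].

Definition nonadj_triples (v : I) : {set {set I}} :=
  [set A : {set I} | [&& A \subset nbhd v, #|A| == 3
                       & [forall u in A, forall w in A, ~~ adj G u w]]].

Local Open Scope ring_scope.

Definition P_ (R : realType) (v : I) : R :=
  'C(gdegree v, 2)%:R - #|edges_within (nbhd v)|%:R.

Definition T_ (R : realType) (v : I) : R := #|nonadj_triples v|%:R.

(* Only used for [M] at least the maximum degree of [G]; in particular, the
   line graph of a k-uniform hypergraph of maximum degree at most D' has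
   maximum degree at most k D'. *)
Definition b_ (R : realType) (M : R) (v : I) : R :=
  (gdegree v)%:R / M - P_ R v / M ^+ 2 + T_ R v / M ^+ 3.

End LocalCounts.

(* Main.v *)
Require Import Defs.
From mathcomp Require Import all_boot all_order all_algebra.
From mathcomp Require Import reals sequences exp.
From mathcomp Require Import ring lra zify.

Set Implicit Arguments.
Unset Strict Implicit.
Unset Printing Implicit Defensive.

Import Order.TTheory GRing.Theory Num.Theory.
Local Open Scope ring_scope.

(* A new colour class is a random matching of the uncoloured edges in which every
   edge appears with probability close to 1/(bM), where M = kD'. One stage of its
   construction runs a Luby-type process: in small time steps vertices of the
   line graph are activated at random, an activated vertex enters the
   independent set if neither it nor a neighbour was activated before, and dummy
   neighbours pad all closed neighbourhoods to size M, so that each vertex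
   enters with probability close to 1/M. If A is the set of neighbours of v
   that are still alive, the probability that v gets a neighbour in the
   independent set is at most |A|/M - P(A)/M^2 + T(A)/M^3 up to a negligible
   error: this potential is a supermartingale, and removing several vertices
   together decreases it at least as much as removing them one by one. So v stays
   free with probability at least 1 - b. The hypothesis applies again to the
   subhypergraph of free edges, with the same D', hence repeating the stage
   gives the total probability (1/M) (1 + (1-b) + (1-b)^2 + ...) = 1/(bM).

   Membership in this matching depends on bounded balls only, so the local lemma
   applied to independent matchings, with an exponential tail bound at every
   vertex, lowers the maximum degree from D' to z at the price of about
   bk(D' - z) colours. These costs telescope, and once D' < eps D / 3 a greedy
   colouring with kD' colours finishes. *)

(** * The potential *)

Section Potential.
Variables (R : realFieldType) (I : finType) (adj : rel I).
Hypothesis adjC : symmetric adj.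
Variable M : R.
Implicit Types A B K : {set I}.

Definition nonadj u w : R := ((u != w) && ~~ adj u w)%:R.
Definition tri u w y : R := nonadj u w * nonadj u y * nonadj w y.
Definition pairs_at A u : R := \sum_(w in A) nonadj u w.
Definition triples_at A u : R := \sum_(w in A) \sum_(y in A) tri u w y.
(** The sums run over ordered pairs and triples, which the factors 2 and 6 compensate: at a
    neighbourhood this is the expression $b_{G,M}$. *)
Definition pot A : R :=
  #|A|%:R / M - (\sum_(u in A) pairs_at A u) / (2 * M ^+ 2)
    + (\sum_(u in A) triples_at A u) / (6 * M ^+ 3).
(** The discrete derivative of [pot] in direction [u]; [triples_at] counts ordered pairs of partners
    of [u], hence the 2. *)
Definition dpot A u : R :=
  M^-1 - pairs_at A u / M ^+ 2 + triples_at A u / (2 * M ^+ 3).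

Lemma nonadjC u w : nonadj u w = nonadj w u.
Proof. by rewrite /nonadj eq_sym adjC. Qed.

Lemma nonadjxx u : nonadj u u = 0.
Proof. by rewrite /nonadj eqxx. Qed.

Lemma nonadj_ge0 u w : 0 <= nonadj u w.
Proof. exact: ler0n. Qed.

Lemma nonadj_le1 u w : nonadj u w <= 1.
Proof. by rewrite /nonadj; case: (_ && _); rewrite ?ler01. Qed.

Lemma tri_ge0 u w y : 0 <= tri u w y.
Proof. by rewrite /tri !mulr_ge0 ?nonadj_ge0. Qed.

Lemma tri_le_nonadj u w y : tri u w y <= nonadj u w.
Proof.
rewrite /tri -mulrA ler_piMr ?nonadj_ge0 //.
by rewrite mulr_ile1 ?nonadj_ge0 ?nonadj_le1.
Qed.

Lemma tri_swap23 u w y : tri u w y = tri u y w.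
Proof. by rewrite /tri (nonadjC y w); ring. Qed.

Lemma tri_swap12 u w y : tri u w y = tri w u y.
Proof. by rewrite /tri (nonadjC w u); ring. Qed.

Lemma pairs_at_ge0 A u : 0 <= pairs_at A u.
Proof. by apply: sumr_ge0 => w _; exact: nonadj_ge0. Qed.

Lemma pairs_at_le A u : pairs_at A u <= #|A|%:R.
Proof.
rewrite -sum1_card natr_sum; apply: ler_sum => w _; exact: nonadj_le1.
Qed.

Lemma triples_at_ge0 A u : 0 <= triples_at A u.
Proof. by apply: sumr_ge0 => w _; apply: sumr_ge0 => y _; exact: tri_ge0. Qed.

Lemma triples_at_le A u : triples_at A u <= #|A|%:R * pairs_at A u.
Proof.
rewrite mulr_sumr; apply: ler_sum => w _.
rewrite -sum1_card natr_sum mulr_suml; apply: ler_sum => y _.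
by rewrite mul1r tri_le_nonadj.
Qed.

Lemma pairs_atD1 A u x : u \in A ->
  pairs_at A x = nonadj x u + pairs_at (A :\ u) x.
Proof. by move=> uA; rewrite /pairs_at (big_setD1 u). Qed.

Lemma triples_atD1 A u x : u \in A ->
  triples_at A x = 2 * (\sum_(y in A :\ u) tri x u y) + triples_at (A :\ u) x.
Proof.
move=> uA; rewrite /triples_at (big_setD1 u) //= (big_setD1 u) //=.
rewrite {1}/tri nonadjxx mulr0 add0r.
under [X in _ + X = _]eq_bigr => w _ do rewrite (big_setD1 u) //= tri_swap23.
by rewrite big_split /=; ring.
Qed.

Lemma potD1 A u : u \in A -> pot (A :\ u) = pot A - dpot A u.
Proof.
move=> uA.
have sP : \sum_(x in A) pairs_at A x
        = 2 * pairs_at A u + \sum_(x in A :\ u) pairs_at (A :\ u) x.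
  rewrite (big_setD1 u) //=.
  under eq_bigr => x _ do rewrite (pairs_atD1 x uA) nonadjC.
  rewrite big_split /= -/(pairs_at (A :\ u) u) (pairs_atD1 u uA) nonadjxx; ring.
have sT : \sum_(x in A) triples_at A x
        = 3 * triples_at A u + \sum_(x in A :\ u) triples_at (A :\ u) x.
  rewrite (big_setD1 u) //=.
  under eq_bigr => x _ do rewrite (triples_atD1 x uA).
  rewrite big_split /= -mulr_sumr.
  have -> : \sum_(x in A :\ u) \sum_(y in A :\ u) tri x u y
          = triples_at (A :\ u) u.
    by apply: eq_bigr => x _; apply: eq_bigr => y _; rewrite tri_swap12.
  have -> : triples_at A u = triples_at (A :\ u) u.
    rewrite (triples_atD1 u uA) big1 ?mulr0 ?add0r // => y _.
    by rewrite /tri nonadjxx !mul0r.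
  ring.
rewrite /pot /dpot sP sT (cardsD1 u A) uA /= natrD.
(* For M = 0 every quotient is 0, since the inverse of 0 is 0. *)
have [->|M0] := eqVneq M 0; first by rewrite !expr0n /= !mulr0 invr0; ring.
by field.
Qed.

(** Deleting [w] removes a negative term [nonadj u w] / M^2 and a positive one of at most |A|
    triples through [u] and [w], each weighing 1 / M^3. As |A| <= M, the former dominates. *)
Lemma dpotD1 A u w : 0 < M -> #|A|%:R <= M -> w \in A ->
  dpot A u <= dpot (A :\ w) u.
Proof.
move=> M0 AM wA.
rewrite /dpot (pairs_atD1 u wA) (triples_atD1 u wA).
set s := \sum_(y in _) _; set p := pairs_at _ _; set t := triples_at _ _.
have sle : s <= M * nonadj u w.
  apply: le_trans (_ : #|A :\ w|%:R * nonadj u w <= _).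
    rewrite -sum1_card natr_sum mulr_suml; apply: ler_sum => y _.
    by rewrite mul1r tri_le_nonadj.
  rewrite ler_wpM2r ?nonadj_ge0 // (le_trans _ AM) // ler_nat.
  by rewrite subset_leq_card ?subD1set.
have M3 : 0 < M ^+ 3 by rewrite exprn_gt0.
rewrite -subr_ge0.
have -> : M^-1 - p / M ^+ 2 + t / (2 * M ^+ 3)
   - (M^-1 - (nonadj u w + p) / M ^+ 2 + (2 * s + t) / (2 * M ^+ 3))
   = (M * nonadj u w - s) / M ^+ 3.
  by have /gt_eqF/negbT M0' := M0; field.
by apply: divr_ge0; rewrite ?subr_ge0 ?(ltW M3).
Qed.

(* Removing several vertices at once decreases the potential at least as much
   as removing them separately; this is what makes correlations harmless. *)
Lemma potDset A K : 0 < M -> #|A|%:R <= M -> K \subset A ->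
  pot (A :\: K) <= pot A - \sum_(u in K) dpot A u.
Proof.
move=> M0 AM; move: {2}#|K| (erefl #|K|) => n; elim: n K A AM => [|n IH] K A AM.
  by move/eqP; rewrite cards_eq0 => /eqP -> _; rewrite setD0 big_set0 subr0.
move=> cK KA.
have /card_gt0P[w wK] : (0 < #|K|)%N by rewrite cK.
have wA : w \in A by apply: (subsetP KA).
have -> : A :\: K = (A :\ w) :\: (K :\ w).
  apply/setP => x; rewrite !inE; case: eqVneq => [->|] //=.
  by rewrite wK.
apply: le_trans (IH (K :\ w) (A :\ w) _ _ _) _.
- by apply: le_trans AM; rewrite ler_nat subset_leq_card ?subD1set.
- by move: cK; rewrite (cardsD1 w K) wK add1n => -[].
- by rewrite setSD.
rewrite potD1 // (big_setD1 w wK) /= -addrA lerD2l -opprD lerN2 lerD2l.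
by apply: ler_sum => u _; exact: dpotD1.
Qed.

(** Since [triples_at] is at most M times [pairs_at], the cubic term of [dpot] makes up for at most
    half of the quadratic one, so every summand is at most 1/M. *)
Lemma sum_dpot_le A : 0 < M -> #|A|%:R <= M -> \sum_(u in A) dpot A u <= 1.
Proof.
move=> M0 AM.
apply: le_trans (_ : #|A|%:R / M <= 1); last by rewrite ler_pdivrMr ?mul1r.
rewrite -sum1_card natr_sum mulr_suml; apply: ler_sum => u _.
rewrite mul1r /dpot.
have h := le_trans (triples_at_le A u) (ler_wpM2r (pairs_at_ge0 A u) AM).
have p0 := pairs_at_ge0 A u.
have M3 : 0 < M ^+ 3 by rewrite exprn_gt0.
rewrite -subr_ge0.
have -> : M^-1 - (M^-1 - pairs_at A u / M ^+ 2 + triples_at A u / (2 * M ^+ 3))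
  = (2 * (M * pairs_at A u) - triples_at A u) / (2 * M ^+ 3).
  by have /gt_eqF/negbT M0' := M0; field.
apply: divr_ge0; last by rewrite mulr_ge0 // ltW.
nra.
Qed.

Lemma dpot_ge0 A u : 0 < M -> #|A|%:R <= M -> 0 <= dpot A u.
Proof.
move=> M0 AM.
rewrite /dpot addr_ge0 //; last first.
  by rewrite divr_ge0 ?triples_at_ge0 // mulr_ge0 // exprn_ge0 // ltW.
rewrite subr_ge0 ler_pdivrMr ?exprn_gt0 // expr2 mulKf ?gt_eqF //.
exact: le_trans (pairs_at_le A u) AM.
Qed.

Lemma pot_le1 A : 0 < M -> #|A|%:R <= M -> pot A <= 1.
Proof.
move=> M0 AM.
have h : \sum_(u in A) triples_at A u <= M * \sum_(u in A) pairs_at A u.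
  rewrite mulr_sumr; apply: ler_sum => u _.
  exact: le_trans (triples_at_le A u) (ler_wpM2r (pairs_at_ge0 A u) AM).
have p0 : 0 <= \sum_(u in A) pairs_at A u.
  by apply: sumr_ge0 => u _; exact: pairs_at_ge0.
rewrite /pot; move: h p0; set t := \sum_(u in A) triples_at A u.
set p := \sum_(u in A) _ => h p0.
have M3 : 0 < M ^+ 3 by rewrite exprn_gt0.
rewrite -subr_ge0.
have -> : 1 - (#|A|%:R / M - p / (2 * M ^+ 2) + t / (6 * M ^+ 3)) =
  (6 * (M - #|A|%:R) * M ^+ 2 + (3 * (M * p) - t)) / (6 * M ^+ 3).
  by have /gt_eqF/negbT M0' := M0; field.
apply: divr_ge0; last by rewrite mulr_ge0 // ltW.
apply: addr_ge0; last by nra.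
by rewrite mulr_ge0 ?exprn_ge0 ?(ltW M0) // mulr_ge0 // subr_ge0.
Qed.

Lemma pot_ge0 A : 0 < M -> #|A|%:R <= M -> 0 <= pot A.
Proof.
move=> M0 AM.
have h : \sum_(u in A) pairs_at A u <= #|A|%:R * M.
  rewrite mulr_natl -sumr_const; apply: ler_sum => u _.
  exact: le_trans (pairs_at_le A u) AM.
rewrite /pot addr_ge0 //; last first.
  rewrite divr_ge0 ?mulr_ge0 ?exprn_ge0 ?(ltW M0) // sumr_ge0 // => u _.
  exact: triples_at_ge0.
rewrite subr_ge0 ler_pdivrMr ?mulr_gt0 ?exprn_gt0 //.
have -> : #|A|%:R / M * (2 * M ^+ 2) = #|A|%:R * M + #|A|%:R * M.
  by have /gt_eqF/negbT M0' := M0; field.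
by rewrite (le_trans h) // lerDl mulr_ge0 // ltW.
Qed.

Local Notation co u w := (1 - nonadj u w).

(** [co u x] says that x equals u or is adjacent to it, so the left side counts non-adjacent pairs
    with a common such x. Multiplying out the two factors gives the terms on the right. *)
Lemma sum_cherries A :
  \sum_(u in A) \sum_(w in A) \sum_(x in A) nonadj u w * co u x * co w x
  = #|A|%:R * (\sum_(u in A) pairs_at A u) + \sum_(u in A) triples_at A u
    - 2 * \sum_(u in A) pairs_at A u ^+ 2.
Proof.
have e1 : \sum_(u in A) \sum_(w in A) \sum_(x in A) nonadj u w
        = #|A|%:R * (\sum_(u in A) pairs_at A u).
  rewrite mulr_sumr; apply: eq_bigr => u _; rewrite mulr_sumr.
  by apply: eq_bigr => w _; rewrite sumr_const mulr_natl.
have e2 : \sum_(u in A) \sum_(w in A) \sum_(x in A) nonadj u w * nonadj u x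
        = \sum_(u in A) pairs_at A u ^+ 2.
  apply: eq_bigr => u _; rewrite expr2 mulr_suml.
  by apply: eq_bigr => w _; rewrite mulr_sumr.
have e3 : \sum_(u in A) \sum_(w in A) \sum_(x in A) nonadj u w * nonadj w x
        = \sum_(u in A) pairs_at A u ^+ 2.
  rewrite exchange_big /=; apply: eq_bigr => w _; rewrite expr2 mulr_suml.
  apply: eq_bigr => u _; rewrite mulr_sumr nonadjC.
  by apply: eq_bigr => x _.
have -> : #|A|%:R * (\sum_(u in A) pairs_at A u) + \sum_(u in A) triples_at A u
    - 2 * \sum_(u in A) pairs_at A u ^+ 2
  = \sum_(u in A) \sum_(w in A) \sum_(x in A) nonadj u w
    - \sum_(u in A) \sum_(w in A) \sum_(x in A) nonadj u w * nonadj u x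
    - \sum_(u in A) \sum_(w in A) \sum_(x in A) nonadj u w * nonadj w x
    + \sum_(u in A) triples_at A u.
  by rewrite e1 e2 e3; ring.
rewrite /triples_at -!sumrB -big_split /=; apply: eq_bigr => u _.
rewrite -!sumrB -big_split /=; apply: eq_bigr => w _.
rewrite -!sumrB -big_split /=; apply: eq_bigr => x _.
by rewrite /tri; ring.
Qed.

(** Fix an independent triple and any x. If s members of the triple are [nonadj] to x, then 2 <= s +
    C(3 - s, 2). Summing over all choices, the symmetry between the three members gives the factors
    3. *)
Lemma sum_tri_co A :
  2 * #|A|%:R * (\sum_(u in A) triples_at A u)
    <= 3 * (\sum_(u in A) pairs_at A u * triples_at A u)
       + 3 * (\sum_(y in A) \sum_(u in A) \sum_(w in A) \sum_(x in A)
                tri u w y * co u x * co w x).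
Proof.
have s4 (F : I -> I -> I -> I -> R) : (forall u w y x, 0 <= F u w y x) ->
    0 <= \sum_(u in A) \sum_(w in A) \sum_(y in A) \sum_(x in A) F u w y x.
  by move=> F0; do 4! [apply: sumr_ge0 => ? _].
have e0 : #|A|%:R * (\sum_(u in A) triples_at A u)
    = \sum_(u in A) \sum_(w in A) \sum_(y in A) \sum_(x in A) tri u w y.
  rewrite mulr_sumr; apply: eq_bigr => u _; rewrite mulr_sumr.
  apply: eq_bigr => w _; rewrite mulr_sumr; apply: eq_bigr => y _.
  by rewrite sumr_const mulr_natl.
have e1 : \sum_(u in A) pairs_at A u * triples_at A u
    = \sum_(u in A) \sum_(w in A) \sum_(y in A) \sum_(x in A)
        tri u w y * nonadj u x.
  apply: eq_bigr => u _; rewrite mulrC mulr_suml.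
  apply: eq_bigr => w _; rewrite mulr_suml; apply: eq_bigr => y _.
  by rewrite mulr_sumr.
have e2 : \sum_(u in A) pairs_at A u * triples_at A u
    = \sum_(u in A) \sum_(w in A) \sum_(y in A) \sum_(x in A)
        tri u w y * nonadj w x.
  rewrite e1 exchange_big /=; apply: eq_bigr => w _; apply: eq_bigr => u _.
  by apply: eq_bigr => y _; apply: eq_bigr => x _; rewrite tri_swap12.
have e3 : \sum_(u in A) pairs_at A u * triples_at A u
    = \sum_(u in A) \sum_(w in A) \sum_(y in A) \sum_(x in A)
        tri u w y * nonadj y x.
  rewrite e2; apply: eq_bigr => u _; rewrite exchange_big /=.
  apply: eq_bigr => y _; apply: eq_bigr => w _.
  by apply: eq_bigr => x _; rewrite tri_swap23.
have f1 : \sum_(y in A) \sum_(u in A) \sum_(w in A) \sum_(x in A)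
                tri u w y * co u x * co w x
  = \sum_(u in A) \sum_(w in A) \sum_(y in A) \sum_(x in A)
                tri u w y * co u x * co w x.
  rewrite exchange_big /=; apply: eq_bigr => u _.
  by rewrite exchange_big /=.
have f2 : \sum_(y in A) \sum_(u in A) \sum_(w in A) \sum_(x in A)
                tri u w y * co u x * co w x
  = \sum_(u in A) \sum_(w in A) \sum_(y in A) \sum_(x in A)
                tri u w y * co u x * co y x.
  rewrite f1; apply: eq_bigr => u _; rewrite exchange_big /=.
  apply: eq_bigr => w _; apply: eq_bigr => y _.
  by apply: eq_bigr => x _; rewrite tri_swap23.
have f3 : \sum_(y in A) \sum_(u in A) \sum_(w in A) \sum_(x in A)
                tri u w y * co u x * co w x
  = \sum_(u in A) \sum_(w in A) \sum_(y in A) \sum_(x in A)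
                tri u w y * co w x * co y x.
  rewrite f2 exchange_big /=; apply: eq_bigr => w _; apply: eq_bigr => u _.
  by apply: eq_bigr => y _; apply: eq_bigr => x _; rewrite tri_swap12.
rewrite -subr_ge0.
set s := \sum_(u in A) _ * _; set c := \sum_(y in A) _.
have -> : 3 * s + 3 * c - 2 * #|A|%:R * (\sum_(u in A) triples_at A u)
   = (s + s + s + c + c + c) - (#|A|%:R * (\sum_(u in A) triples_at A u)
      + #|A|%:R * (\sum_(u in A) triples_at A u)) by ring.
rewrite {1}/s e1 {1}/s e2 {1}/s e3 {1}/c f1 {1}/c f2 {1}/c f3 e0.
rewrite -!big_split /= -sumrB; apply: sumr_ge0 => u _.
rewrite -!big_split /= -sumrB; apply: sumr_ge0 => w _.
rewrite -!big_split /= -sumrB; apply: sumr_ge0 => y _.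
rewrite -!big_split /= -sumrB; apply: sumr_ge0 => x _.
have -> (t a b d : R) : t * a + t * b + t * d + t * (1 - a) * (1 - b)
    + t * (1 - a) * (1 - d) + t * (1 - b) * (1 - d) - (t + t)
  = t * (1 - (a + b + d) + (a * b + a * d + b * d)) by ring.
rewrite mulr_ge0 ?tri_ge0 // /nonadj.
by do 3! case: (_ && _) => /=; rewrite !(mulr0, mulr1, mul0r, addr0, add0r); lra.
Qed.

(** The drift of the potential in the limit of small time steps. A vertex of [A] is activated at
    rate |A|, and the value then jumps to 1. A vertex [u] of [A] is killed from outside at rate M -
    |A| + [pairs_at A u], the number of elements of its padded closed neighbourhood outside [A], and
    [dpot A u] is then lost. The inequality says that the drift is not positive. *)
Lemma pot_generator A : 0 < M -> #|A|%:R <= M ->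
  #|A|%:R * (1 - pot A)
    <= \sum_(u in A) (M - #|A|%:R + pairs_at A u) * dpot A u.
Proof.
move=> M0 AM.
set a : R := #|A|%:R.
set p := \sum_(u in A) pairs_at A u; set t := \sum_(u in A) triples_at A u.
set pp := \sum_(u in A) pairs_at A u ^+ 2.
set pt := \sum_(u in A) pairs_at A u * triples_at A u.
pose X := a * p + t - 2 * pp.
(* [X] is the count of [sum_cherries]. The third member y of the triple in [sum_tri_co] is dropped
   by [tri_le_nonadj], at the price of a factor |A| <= M. *)
have MXge : 2 * a * t <= 3 * pt + 3 * (M * X).
  apply: le_trans (sum_tri_co A) _; rewrite lerD2l ler_wpM2l // /X.
  rewrite -sum_cherries.
  apply: (@le_trans _ _ (a * (\sum_(u in A) \sum_(w in A) \sum_(x in A)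
              nonadj u w * (1 - nonadj u x) * (1 - nonadj w x)))).
    rewrite {1}/a mulr_natl -sumr_const; apply: ler_sum => y _.
    apply: ler_sum => u _; apply: ler_sum => w _; apply: ler_sum => x _.
    have c0 v z : 0 <= 1 - nonadj v z by rewrite subr_ge0 nonadj_le1.
    have := ler_wpM2r (mulr_ge0 (c0 u x) (c0 w x)) (tri_le_nonadj u w y).
    by rewrite !mulrA.
  rewrite ler_wpM2r //; do 3! [apply: sumr_ge0 => ? _].
  by rewrite !mulr_ge0 ?subr_ge0 ?nonadj_le1 ?nonadj_ge0.
have -> : \sum_(u in A) (M - a + pairs_at A u) * dpot A u
   = (M - a) * (a / M - p / M ^+ 2 + t / (2 * M ^+ 3))
     + (p / M - pp / M ^+ 2 + pt / (2 * M ^+ 3)).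
  have -> : a / M = \sum_(u in A) M^-1 by rewrite sumr_const mulr_natl.
  rewrite /p /t /pp /pt !mulr_suml -!sumrB -!big_split /= mulr_sumr -big_split /=.
  by apply: eq_bigr => u _; rewrite /dpot; ring.
rewrite /pot -/a -/p -/t -subr_ge0.
have -> : (M - a) * (a / M - p / M ^+ 2 + t / (2 * M ^+ 3))
     + (p / M - pp / M ^+ 2 + pt / (2 * M ^+ 3))
     - a * (1 - (a / M - p / (2 * M ^+ 2) + t / (6 * M ^+ 3)))
  = (3 * pt + 3 * (M * X) - 2 * a * t) / (6 * M ^+ 3).
  by have /gt_eqF/negbT M0' := M0; rewrite /X; field.
by rewrite divr_ge0 ?subr_ge0 // mulr_ge0 // exprn_ge0 // ltW.
Qed.
End Potential.

(** * Finite probability and the local lemma *)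

Section Expectation.
Variable R : realFieldType.

Definition expect (T : finType) (f : T -> R) : R := (\sum_t f t) / #|T|%:R.

Lemma eq_expect (T : finType) (f g : T -> R) : f =1 g -> expect f = expect g.
Proof. by move=> fg; congr (_ / _); apply: eq_bigr. Qed.

Lemma le_expect (T : finType) (f g : T -> R) :
  (forall t, f t <= g t) -> expect f <= expect g.
Proof.
by move=> fg; rewrite ler_wpM2r ?invr_ge0 ?ler0n // ler_sum.
Qed.

Lemma expectD (T : finType) (f g : T -> R) :
  expect (fun t => f t + g t) = expect f + expect g.
Proof. by rewrite /expect big_split mulrDl. Qed.

Lemma expectZ (T : finType) (c : R) (f : T -> R) :
  expect (fun t => c * f t) = c * expect f.
Proof. by rewrite /expect -mulr_sumr mulrA. Qed.

Lemma expectB (T : finType) (f g : T -> R) :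
  expect (fun t => f t - g t) = expect f - expect g.
Proof. by rewrite /expect sumrB mulrBl. Qed.

Lemma expect_sum (T J : finType) (P : pred J) (f : J -> T -> R) :
  expect (fun t => \sum_(j | P j) f j t) = \sum_(j | P j) expect (f j).
Proof. by rewrite /expect exchange_big mulr_suml. Qed.

Lemma expect_cst (T : finType) (c : R) :
  (0 < #|T|)%N -> expect (fun _ : T => c) = c.
Proof.
by move=> T0; rewrite /expect sumr_const -[c *+ _]mulr_natr mulfK // pnatr_eq0 -lt0n.
Qed.

Lemma expect_ge0 (T : finType) (f : T -> R) :
  (forall t, 0 <= f t) -> 0 <= expect f.
Proof. by move=> f0; rewrite divr_ge0 ?ler0n // sumr_ge0. Qed.

Lemma expect_prod (T1 T2 : finType) (f : T1 * T2 -> R) :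
  expect f = expect (fun a => expect (fun b => f (a, b))).
Proof.
rewrite /expect -mulr_suml pair_bigA /= card_prod natrM invfM.
by rewrite mulrAC mulrA; congr (_ * _ * _); apply: eq_bigr => -[].
Qed.

Lemma expect_unit (f : unit -> R) : expect f = f tt.
Proof. by rewrite /expect card_unit divr1 (big_pred1 tt) // => -[]. Qed.

Definition prob (T : finType) (P : pred T) : R := expect (fun t => (P t)%:R).

Lemma prob_ge0 (T : finType) (P : pred T) : 0 <= prob P.
Proof. by apply: expect_ge0 => t; exact: ler0n. Qed.

Lemma le_prob (T : finType) (P Q : pred T) : subpred P Q -> prob P <= prob Q.
Proof.
move=> PQ; apply: le_expect => t; rewrite ler_nat.
by case: (boolP (P t)) => // /PQ ->.
Qed.

Lemma eq_prob (T : finType) (P Q : pred T) : P =1 Q -> prob P = prob Q.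
Proof. by move=> PQ; apply: eq_expect => t; rewrite PQ. Qed.

(** The value [ord0] means that a bit is on, so each bit is off with probability q / (q + 1). *)
Definition quiet (J : finType) (q : nat) (X : {set J})
  (t : {ffun J -> 'I_q.+1}) : bool := [forall x in X, t x != ord0].

Lemma quietU (J : finType) q (X Y : {set J}) (t : {ffun J -> 'I_q.+1}) :
  quiet (X :|: Y) t = quiet X t && quiet Y t.
Proof.
apply/forall_inP/andP => [h|[/forall_inP hX /forall_inP hY] x].
  by split; apply/forall_inP => x xX; apply: h; rewrite inE xX ?orbT.
by rewrite inE => /orP[/hX|/hY].
Qed.

Lemma prob_quiet (J : finType) (q : nat) (X : {set J}) :
  prob (@quiet J q X) = (q%:R / q.+1%:R) ^+ #|X|.
Proof.
pose F x (b : 'I_q.+1) : R := if x \in X then (b != ord0)%:R else 1.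
have -> : prob (@quiet J q X)
        = (\sum_(t : {ffun J -> 'I_q.+1}) \prod_x F x (t x))
          / #|{ffun J -> 'I_q.+1}|%:R.
  congr (_ / _); apply: eq_bigr => t _; rewrite /F.
  case: (boolP (quiet X t)) => [/forall_inP h|].
    by rewrite big1 // => x _; case: ifP => // /h ->.
  rewrite negb_forall_in => /exists_inP[x xX /negPn/eqP tx].
  by rewrite (bigD1 x) //= xX tx eqxx mul0r.
rewrite -(bigA_distr_bigA F) card_ffun card_ord natrX.
have -> : q.+1%:R ^+ #|J| = \prod_(x : J) q.+1%:R :> R by rewrite prodr_const.
rewrite -prodf_div (bigID [in X]) /= -[RHS]mulr1 -prodr_const; congr (_ * _).
  apply: eq_bigr => x xX; rewrite /F xX big_ord_recl eqxx add0r.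
  by under eq_bigr do rewrite /=; rewrite sumr_const card_ord.
rewrite big1 // => x /negbTE xX; rewrite /F xX sumr_const card_ord.
by rewrite divff // pnatr_eq0.
Qed.
End Expectation.

(** * The local lemma *)

Section LocalLemma.
Variables (R : realFieldType) (I : finType).

(* Random data attached to the elements of [I]: [mix S a b] takes the data of
   [a] on [S] and those of [b] elsewhere, [agree S a b] says that [a] and [b]
   carry the same data on [S]. *)
Record local_space (T : finType) := LocalSpace {
  mix : {set I} -> T -> T -> T;
  agree : {set I} -> T -> T -> Prop;
  mixK : forall S a b, mix S (mix S a b) (mix S b a) = a;
  agree_mixl : forall S a b, agree S (mix S a b) a;
  agree_mixr : forall (S S' : {set I}) a b, [disjoint S & S'] -> agree S' (mix S a b) b
}.

Definition local_event T (X : local_space T) (S : {set I}) (A : pred T) :=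
  forall a b, agree X S a b -> A a = A b.

(** Exchanging the data on [S] between two samples is an involution on pairs of samples. *)
Lemma expect_swap T (X : local_space T) (S : {set I}) (f : T -> T -> R) :
  \sum_a \sum_b f (mix X S a b) (mix X S b a) = \sum_a \sum_b f a b.
Proof.
rewrite !pair_bigA /=; symmetry.
pose h (u : T * T) := (mix X S u.1 u.2, mix X S u.2 u.1).
have hK : cancel h h by case=> a b; rewrite /h /= !mixK.
rewrite (reindex h) /=; last by exists h => u _; exact: hK.
by apply: eq_bigr.
Qed.

(** The data on [S] are resampled: after the exchange, [A] reads only the first sample and [B] only
    the second. *)
Lemma prob_local_indep T (X : local_space T) (S : {set I}) (A B : pred T) :
  local_event X S A ->
  (forall a b, B (mix X S a b) = B b) ->
  prob R [pred t | A t && B t] = prob R A * prob R B.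
Proof.
move=> locA locB; rewrite /prob /expect.
(* For empty [T] all probabilities are 0 by the convention on inverses. *)
have [T0|T0] := eqVneq #|T|%:R (0 : R); first by rewrite T0 invr0 !mulr0.
suff h : (\sum_t (A t && B t)%:R) * #|T|%:R
       = (\sum_t (A t)%:R) * (\sum_t (B t)%:R) :> R.
  rewrite mulrACA -h mulrA mulfK //.
rewrite mulr_suml; under eq_bigr do rewrite mulr_natr -sumr_const.
rewrite -(expect_swap X S (fun a _ => (A a && B a)%:R)) mulr_suml.
apply: eq_bigr => a _; rewrite mulr_sumr; apply: eq_bigr => b _.
by rewrite locB (locA (mix X S a b) a) ?mulnb -?natrM ?mulnb //; exact: agree_mixl.
Qed.

(** The symmetric form. The usual induction bounds the probability of [A x] given [N W] by 2p; it is
    stated as a product, because [N W] is only later seen to have positive probability. *)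
Lemma lovasz_local_lemma T (X : local_space T) (V : finType)
    (A : V -> pred T) (S : V -> {set I}) (d : nat) (p : R) :
  (0 < #|T|)%N -> (0 < d)%N ->
  (forall x, local_event X (S x) (A x)) ->
  (forall x, prob R (A x) <= p) ->
  (forall x, (#|[set y | ~~ [disjoint S x & S y]]| <= d)%N) ->
  4 * d%:R * p <= 1 ->
  exists t, forall x, ~~ A x t.
Proof.
move=> T0 d0 locA probA degS pd.
pose N (W : {set V}) : pred T := [pred t | [forall y in W, ~~ A y t]].
have [V0|/card_gt0P[x0 _]] := posnP #|V|.
  have /card_gt0P[t _] := T0; exists t => x.
  by move: (card0_eq V0 x); rewrite inE.
have p0 : 0 <= p := le_trans (prob_ge0 _ _) (probA x0).
have p4 : 4 * p <= 1.
  have : (1 : R) <= d%:R by rewrite ler1n.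
  nra.
have indep x (W : {set V}) : (forall y, y \in W -> [disjoint S x & S y]) ->
    prob R [pred t | A x t && N W t] = prob R (A x) * prob R (N W).
  move=> dis; apply: (prob_local_indep (locA x)) => a b; rewrite /N /=.
  apply: eq_forallb => y; case: (boolP (y \in W)) => //= /dis dxy.
  by congr (~~ _); apply: (locA y); exact: agree_mixr.
have step n : forall (W : {set V}) x, (#|W| < n)%N ->
    prob R [pred t | A x t && N W t] <= 2 * p * prob R (N W).
  elim: n => // n IH W x Wn.
  (* [W1] collects the events of [W] that may depend on [A x]; those of [W2] are jointly independent
     of it. *)
  pose W1 := [set y in W | ~~ [disjoint S x & S y]].
  pose W2 := W :\: W1.
  have le1 : prob R [pred t | A x t && N W t] <= p * prob R (N W2).
    apply: le_trans (_ : prob R [pred t | A x t && N W2 t] <= _).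
      apply: le_prob => t /= /andP[-> /forall_inP h]; apply/forall_inP => y.
      by rewrite inE => /andP[_ /h].
    rewrite indep ?ler_wpM2r ?prob_ge0 // => y.
    by rewrite !inE negb_and negbK => /andP[/orP[/negP|//] nW /nW].
  have le2 : prob R (N W2)
      <= prob R (N W) + \sum_(y in W1) prob R [pred t | A y t && N W2 t].
    rewrite /prob -expect_sum -expectD; apply: le_expect => t.
    case: (boolP (N W2 t)) => NW2; last by rewrite addr_ge0 ?sumr_ge0.
    case: (boolP (N W t)) => NW; first by rewrite lerDl sumr_ge0.
    move: NW; rewrite /N /= negb_forall_in => /exists_inP[y yW /negPn Ay].
    have yW1 : y \in W1.
      apply/negPn/negP => nyW1; move/forall_inP: NW2 => /(_ y).
      by rewrite inE nyW1 yW Ay => /(_ isT).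
    move: NW2; rewrite /N /= => NW2; rewrite add0r (bigD1 y) //= Ay NW2 lerDl.
    by apply: sumr_ge0 => z _; rewrite ler0n.
  (* A member of [W1] makes [W2] smaller than [W], so the induction hypothesis applies to [W2]. *)
  have le3 : \sum_(y in W1) prob R [pred t | A y t && N W2 t]
      <= d%:R * (2 * p * prob R (N W2)).
    apply: le_trans (_ : \sum_(y in W1) 2 * p * prob R (N W2) <= _).
      apply: ler_sum => y yW1; apply: IH; rewrite -ltnS (leq_trans _ Wn) // ltnS.
      apply: proper_card; rewrite properEneq subsetDl andbT.
      have yW : y \in W by move: yW1; rewrite inE => /andP[].
      by apply: contraTneq yW => <-; rewrite inE yW1.
    rewrite sumr_const -[_ *+ _]mulr_natl.
    apply: ler_wpM2r; first by rewrite mulr_ge0 ?prob_ge0 ?mulr_ge0.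
    rewrite ler_nat (leq_trans _ (degS x)) // subset_leq_card //.
    by apply/subsetP => y; rewrite !inE => /andP[].
  have N0 := prob_ge0 R (N W2).
  have le4 : d%:R * (2 * p * prob R (N W2)) <= prob R (N W2) / 2.
    have := ler_wpM2r N0 pd; lra.
  have : prob R (N W2) <= 2 * prob R (N W) by lra.
  by move/(ler_wpM2l p0); lra.
(* Avoiding one more event keeps at least the fraction 1 - 2p >= 1/2 of the probability. *)
have pos n : forall (W : {set V}), #|W| = n -> 0 < prob R (N W).
  elim: n => [|n IH] W cW.
    have -> : W = set0 by apply/eqP; rewrite -cards_eq0 cW.
    rewrite (@eq_prob _ _ _ predT) => [|t].
      by rewrite /prob expect_cst.
    by apply/forall_inP => y; rewrite inE.
  have /card_gt0P[x xW] : (0 < #|W|)%N by rewrite cW.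
  have cW' : #|W :\ x| = n by move: cW; rewrite (cardsD1 x) xW => -[].
  have := step n.+1 (W :\ x) x; rewrite cW' ltnS leqnn => /(_ isT) st.
  have Nx := IH _ cW'.
  have le5 : prob R (N (W :\ x))
      <= prob R (N W) + prob R [pred t | A x t && N (W :\ x) t].
    rewrite /prob -expectD; apply: le_expect => t /=.
    case: (boolP (N (W :\ x) t)) => [/forall_inP h|_]; last first.
      by rewrite andbF addr0 ler0n.
    rewrite andbT.
    case: (boolP (A x t)) => Axt /=; first by rewrite lerDr.
    rewrite addr0 ler_nat lt0b; apply/forall_inP => y yW.
    by have [->//|yx] := eqVneq y x; apply: h; rewrite !inE yx.
  nra.
have /lt0r_neq0 := pos _ [set: V] erefl.
rewrite /prob /expect mulf_eq0 negb_or => /andP[+ _].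
move=> h; have [t Nt] : exists t, N setT t.
  apply/existsP; apply: contraNT h; rewrite negb_exists => /forallP h.
  by rewrite big1 // => t _; rewrite (negbTE (h t)).
by exists t => x; move/forall_inP: Nt; apply; rewrite inE.
Qed.
End LocalLemma.

(** An iterated product rather than a function type, so that [expect_prod] splits off one factor in
    inductions over time. *)
Fixpoint power (T : finType) (n : nat) : finType :=
  if n is n'.+1 then (T * power T n')%type else unit.

Section LocalSpaces.
Variable I : finType.

Fixpoint power_mix (T : finType) (X : local_space I T) n (S : {set I}) :
    power T n -> power T n -> power T n :=
  if n is n'.+1 then fun a b => (mix X S a.1 b.1, power_mix X S a.2 b.2)
  else fun a _ => a.

Fixpoint power_agree (T : finType) (X : local_space I T) n (S : {set I}) :
    power T n -> power T n -> Prop :=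
  if n is n'.+1 then fun a b => agree X S a.1 b.1 /\ power_agree X S a.2 b.2
  else fun _ _ => True.

Definition power_space (T : finType) (X : local_space I T) n :
  local_space I (power T n).
Proof.
apply: (@LocalSpace _ _ (@power_mix T X n) (@power_agree T X n)).
- by elim: n => //= n IH S [a a'] [b b'] /=; rewrite mixK IH.
- elim: n => //= n IH S [a a'] [b b'] /=; split; last exact: IH.
  exact: agree_mixl.
- elim: n => //= n IH S S' [a a'] [b b'] dis /=; split; last exact: IH.
  exact: agree_mixr.
Defined.

Definition table_space (J B : finType) (f : J -> I) :
  local_space I {ffun J -> B}.
Proof.
apply: (@LocalSpace _ _
  (fun S (a b : {ffun J -> B}) => [ffun x => if f x \in S then a x else b x])
  (fun S a b => forall x, f x \in S -> a x = b x)).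
- by move=> S a b; apply/ffunP => x; rewrite !ffunE; case: (f x \in S).
- by move=> S a b x; rewrite !ffunE => ->.
- move=> S S' a b dis x xS'; rewrite !ffunE; case: ifP => // xS.
  by move/disjointFr: dis => /(_ _ xS); rewrite xS'.
Defined.

Lemma card_power_gt0 (T : finType) n : (0 < #|T|)%N -> (0 < #|power T n|)%N.
Proof.
by move=> T0; elim: n => [|n IH] /=; rewrite ?card_unit ?card_prod ?muln_gt0 ?T0.
Qed.
End LocalSpaces.

(** * One random matching *)

Section Bernoulli.
Variables (R : realFieldType) (r : R).
Hypotheses (r0 : 0 <= r) (r1 : r <= 1).

Lemma exprn_Bernoulli n : 1 - r ^+ n <= n%:R * (1 - r).
Proof.
elim: n => [|n IH]; first by rewrite expr0 mul0r subrr.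
have rn1 : r ^+ n <= 1 by rewrite exprn_ile1.
have : 0 <= (1 - r) * (1 - r ^+ n) by rewrite mulr_ge0 ?subr_ge0.
by rewrite exprS -natr1; lra.
Qed.

(** 1 - r^(n+1) is 1 - r times a sum of n + 1 powers of r, each at least r^n. *)
Lemma exprn_Bernoulli_rev n : n.+1%:R * (1 - r) * r ^+ n <= 1 - r ^+ n.+1.
Proof.
elim: n => [|n IH]; first by rewrite expr0 expr1; lra.
have rn1 : r ^+ n.+1 <= 1 by rewrite exprn_ile1.
have rn0 : 0 <= r ^+ n.+1 by rewrite exprn_ge0.
have := ler_wpM2l r0 IH; rewrite mulrCA -exprS => {}IH.
have : 0 <= (1 - r) * (1 - r ^+ n.+1) by rewrite mulr_ge0 ?subr_ge0.
by rewrite -natr1 [r ^+ n.+2]exprS; lra.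
Qed.

Lemma exprn_Bernoulli_rev' n : n%:R * (1 - r) * r ^+ n <= 1 - r ^+ n.
Proof.
case: n => [|n]; first by rewrite expr0 subrr !mul0r.
apply: le_trans (exprn_Bernoulli_rev n); rewrite exprS mulrCA.
by rewrite ler_piMl // !mulr_ge0 ?exprn_ge0 ?subr_ge0.
Qed.
End Bernoulli.

(** * The Luby-type process *)

Section Process.
Variables (R : realFieldType) (I : finType) (adj : rel I).
Hypotheses (adjC : symmetric adj) (adjxx : irreflexive adj).
Variables (m q L : nat).
Implicit Types U A B S F : {set I}.

Definition nbr U u : {set I} := [set z in U | adj u z].

(* Bit [(u, 0)] activates [u]; the bits [(u, i)] with [i] above the degree of
   [u] stand for dummy neighbours, which pad all closed neighbourhoods to size
   [m.+1]. A bit is on with probability [1 / q.+1]. *)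
Definition step := {ffun I * 'I_m.+1 -> 'I_q.+1}.

Definition own A : {set I * 'I_m.+1} := [set x | (x.1 \in A) && (x.2 == ord0)].

(** Dummy bits fill up the activation bits of the neighbours to exactly m bits, whenever the degree
    is at most m. *)
Definition killers U u : {set I * 'I_m.+1} :=
  own (nbr U u) :|: [set x : I * 'I_m.+1 | (x.1 == u) && (#|nbr U u| < x.2)%N].

(** [A] holds the vertices still alive in [U]. Killers range over [U]: the activation of a dead
    vertex still kills, which makes the chance to enter independent of the past of the
    neighbours. *)
Definition entering U A (t : step) : {set I} :=
  [set u in A | (t (u, ord0) == ord0) && quiet (killers U u) t].

Definition surviving U A (t : step) : {set I} :=
  [set u in A | (t (u, ord0) != ord0) && quiet (killers U u) t].

Fixpoint entered l U A : power step l -> {set I} :=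
  if l is l'.+1 then fun w =>
    entering U A w.1 :|: entered U (surviving U A w.1) w.2
  else fun _ => set0.

Let rho : R := q%:R / q.+1%:R.

Let rho_ge0 : 0 <= rho. Proof. by rewrite divr_ge0. Qed.
Let rho_le1 : rho <= 1.
Proof. by rewrite ler_pdivrMr ?ltr0n // mul1r ler_nat. Qed.

Lemma card_own A : #|own A| = #|A|.
Proof.
rewrite -(card_imset A (_ : injective (fun u => (u, ord0 : 'I_m.+1)))).
  apply: eq_card => -[u i]; rewrite !inE /=; apply/andP/imsetP => [[uA /eqP ->]|].
    by exists u.
  by case=> w wA [-> ->].
by move=> u w [].
Qed.

Lemma ownU A B : own (A :|: B) = own A :|: own B.
Proof. by apply/setP => x; rewrite !inE andb_orl. Qed.

Lemma quiet_own1 u (t : step) : quiet (own [set u]) t = (t (u, ord0) != ord0).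
Proof.
apply/forall_inP/idP => [h|tu [w i]]; first by apply: h; rewrite !inE !eqxx.
by rewrite !inE /= => /andP[/eqP -> /eqP ->].
Qed.

Lemma card_own_killers U B u : (#|nbr U u| <= m)%N ->
  #|own B :|: killers U u| = (#|B :|: nbr U u| + (m - #|nbr U u|))%N.
Proof.
move=> deg; rewrite /killers setUA -ownU cardsU card_own.
have -> : own (B :|: nbr U u)
    :&: [set x : I * 'I_m.+1 | (x.1 == u) && (#|nbr U u| < x.2)%N] = set0.
  apply/setP => -[w i]; rewrite !inE /=.
  by case: (eqVneq i ord0) => [->|]; rewrite ?ltn0 ?andbF.
rewrite cards0 subn0; congr (_ + _)%N.
(* The dummy bits have the indices from degree + 1 to m; index 0 is the activation bit of [u]. *)
pose f (j : 'I_(m - #|nbr U u|)) : I * 'I_m.+1 := (u, inord (#|nbr U u| + j.+1)).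
have fv (j : 'I_(m - #|nbr U u|)) : (#|nbr U u| + j.+1 < m.+1)%N.
  by rewrite ltnS addnS -ltn_subRL.
have fI : injective f.
  move=> i j [] /(congr1 val); rewrite /= !inordK ?fv // => /addnI [] ?.
  exact: val_inj.
rewrite -[RHS]card_ord -(card_imset _ fI); apply: eq_card => -[w i].
rewrite !inE /=; apply/andP/imsetP => [[/eqP -> lt]|[j _ [-> ->]]]; last first.
  by rewrite eqxx inordK ?fv // addnS ltnS leq_addr.
have lt' : (i - (#|nbr U u|).+1 < m - #|nbr U u|)%N.
  by rewrite subnSK // leq_sub2r // -ltnS ltn_ord.
exists (Ordinal lt') => //; rewrite /f; congr (_, _); apply: val_inj.
by rewrite /= inordK ?(fv (Ordinal lt')) //= subnSK // subnKC // ltnW.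
Qed.

Lemma killers_quiet_card U u : (#|nbr U u| <= m)%N -> #|killers U u| = m.
Proof.
move=> deg; have := card_own_killers set0 deg.
rewrite set0U subnKC // => h; apply: etrans h; apply: eq_card => x.
by rewrite in_setU (_ : own set0 = set0) ?in_set0 //; apply/setP => y; rewrite !inE.
Qed.

Lemma prob_surviving U A u : u \in A -> (#|nbr U u| <= m)%N ->
  prob R [pred t | u \in surviving U A t] = rho ^+ m.+1.
Proof.
move=> uA deg.
rewrite (@eq_prob _ _ _ (quiet (own [set u] :|: killers U u))) => [|t].
  rewrite prob_quiet card_own_killers // cardsU1 inE adjxx andbF.
  by rewrite add1n addSn subnKC.
by rewrite /= inE uA quietU quiet_own1.
Qed.

Lemma prob_entering U A u : u \in A -> (#|nbr U u| <= m)%N ->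
  prob R [pred t | u \in entering U A t] = rho ^+ m - rho ^+ m.+1.
Proof.
move=> uA deg; rewrite -(prob_surviving uA deg).
have -> : rho ^+ m = prob R (quiet (q := q) (killers U u)).
  by rewrite prob_quiet killers_quiet_card.
rewrite /prob -expectB; apply: eq_expect => t /=.
rewrite !inE uA /=; case: quiet; rewrite ?andbF ?subrr // !andbT.
by case: (_ == _); rewrite ?subr0 ?subrr.
Qed.

Lemma entered_sub l U A (w : power step l) : entered U A w \subset A.
Proof.
elim: l A w => [|l IH] A w /=; first exact: sub0set.
rewrite subUset (subset_trans (IH _ _)) ?andbT.
  by apply/subsetP => u; rewrite inE => /andP[].
by apply/subsetP => u; rewrite inE => /andP[].
Qed.

(** An entering vertex is activated, so in the same step its neighbours neither enter nor
    survive. *)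
Lemma entered_indep l U A (w : power step l) : A \subset U ->
  {in entered U A w &, forall u v, ~~ adj u v}.
Proof.
move=> AU; elim: l A AU w => [|l IH] A AU w u v /=; first by rewrite inE.
have loud x y : adj x y -> x \in entering U A w.1 ->
    quiet (killers U y) w.1 -> false.
  rewrite inE => xy /and3P[xA tx _] /forall_inP /(_ (x, ord0)).
  by rewrite !inE (subsetP AU) // adjC xy tx eqxx => /(_ isT).
have sAU : surviving U A w.1 \subset U.
  by apply: subset_trans AU; apply/subsetP => x; rewrite inE => /andP[].
have ens x : x \in entering U A w.1 -> quiet (killers U x) w.1.
  by rewrite inE => /and3P[].
have lats x : x \in entered U (surviving U A w.1) w.2 ->
    quiet (killers U x) w.1.
  by move/(subsetP (entered_sub _ _ _)); rewrite inE => /and3P[].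
rewrite !in_setU => /orP[uE|uL] /orP[vE|vL]; apply/negP => uv.
- by have := loud _ _ uv uE (ens _ vE).
- by have := loud _ _ uv uE (lats _ vL).
- by rewrite adjC in uv; have := loud _ _ uv vE (lats _ uL).
- by move/negP: (IH _ sAU _ _ _ uL vL).
Qed.

(** A vertex enters in the current step, or it survives the step, with probability rho^(m+1), and
    enters later. *)
Definition enter_prob l : R :=
  iter l (fun x => rho ^+ m - rho ^+ m.+1 + rho ^+ m.+1 * x) 0.

Lemma prob_entered l U A u : u \in A -> (#|nbr U u| <= m)%N ->
  prob R [pred w : power step l | u \in entered U A w] = enter_prob l.
Proof.
move=> + deg; elim: l A => [|l IH] A uA.
  by rewrite /prob expect_unit /= inE.
rewrite /enter_prob iterS -/(enter_prob l) /prob expect_prod.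
rewrite -(prob_entering uA deg) -(prob_surviving uA deg) mulrC /prob -expectZ.
rewrite -expectD; apply: eq_expect => t /=.
case: (boolP (u \in surviving U A t)) => us.
  have ue : u \in entering U A t = false.
    by move: us; rewrite !inE => /and3P[_ /negbTE -> _]; rewrite andbF.
  rewrite ue add0r mulr1 -(IH _ us); apply: eq_expect => w /=.
  by rewrite in_setU ue.
rewrite mulr0 addr0 -[RHS](@expect_cst R (power step l)); last first.
  by rewrite card_power_gt0 // card_ffun card_ord expn_gt0.
apply: eq_expect => w /=; rewrite in_setU [X in _ || X](negbTE _) ?orbF //.
by apply: contra us; exact/subsetP/entered_sub.
Qed.

(** The increasing affine recursion does not raise the value 1/(m + 1), by [exprn_Bernoulli_rev]. *)
Lemma enter_prob_le l : enter_prob l <= m.+1%:R^-1.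
Proof.
elim: l => [|l IH]; first by rewrite invr_ge0.
rewrite /enter_prob iterS -/(enter_prob l).
have h := ler_wpM2l (exprn_ge0 m.+1 rho_ge0) IH.
have := exprn_Bernoulli_rev rho_ge0 rho_le1 m.
have m0 : 0 < m.+1%:R :> R by rewrite ltr0n.
rewrite -mulrA mulrC -ler_pdivlMr // => h'.
have e : (1 - rho) * rho ^+ m = rho ^+ m - rho ^+ m.+1 by rewrite exprS; ring.
rewrite e in h'; move: h h'; move: (m.+1%:R^-1) (rho ^+ m.+1) => y x; lra.
Qed.

(** Each step contracts by rho^(m+1) towards a fixed point that is at least rho^m / (m + 1). *)
Lemma enter_prob_ge l :
  rho ^+ m / m.+1%:R * (1 - rho ^+ m.+1 ^+ l) <= enter_prob l.
Proof.
elim: l => [|l IH]; first by rewrite expr0 subrr mulr0.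
rewrite /enter_prob iterS -/(enter_prob l).
have h := ler_wpM2l (exprn_ge0 m.+1 rho_ge0) IH.
have c0 : 0 <= rho ^+ m / m.+1%:R by rewrite divr_ge0 ?exprn_ge0.
have := ler_wpM2l c0 (exprn_Bernoulli rho_ge0 rho_le1 m.+1).
have -> : rho ^+ m / m.+1%:R * (m.+1%:R * (1 - rho)) = rho ^+ m - rho ^+ m.+1.
  by rewrite mulrA divfK ?pnatr_eq0 // exprS; ring.
rewrite [_ ^+ l.+1]exprS; move: h IH.
move: (rho ^+ m.+1) (rho ^+ m / m.+1%:R) => x c; lra.
Qed.

(** * The potential along the process *)

Local Notation M := (m.+1%:R : R).
Local Notation p := (1 - rho).
Local Notation pot := (pot adj M).

Lemma pairs_at_nbr U B u : B \subset U -> u \in B ->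
  pairs_at R adj B u = #|B|%:R - 1 - #|nbr U u :&: B|%:R.
Proof.
move=> BU uB; rewrite /pairs_at (big_setD1 u) //= nonadjxx add0r.
rewrite (eq_bigr (fun w => 1 - (adj u w)%:R)); last first.
  move=> w; rewrite in_setD1 /nonadj eq_sym => /andP[-> _] /=.
  by case: (adj u w); rewrite ?subrr ?subr0.
rewrite sumrB sumr_const (cardsD1 u B) uB natrD.
have -> : \sum_(w in B :\ u) (adj u w)%:R = #|nbr U u :&: B|%:R :> R.
  rewrite -sum1_card natr_sum [in LHS]big_mkcond [in RHS]big_mkcond /=.
  apply: eq_bigr => w _; rewrite in_setI in_setD1 [w \in nbr _ _]inE.
  case: (boolP (w \in B)) => [wB|]; last by rewrite !andbF.
  rewrite (subsetP BU) // !andbT /=; case: eqVneq => [->|_] /=.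
    by rewrite adjxx.
  by case: adj.
by rewrite /=; ring.
Qed.

(** Once a living neighbour of [v] is activated, the value 1 is charged. Otherwise [potDset] bounds
    the new potential. To first order in the activation probability p the change is the drift of
    [pot_generator]; second-order terms form the error. *)
Lemma pot_step U A v : (forall u, u \in U -> (#|nbr U u| <= m)%N) -> v \in U ->
  expect (fun t : step =>
    (~~ quiet (own (nbr U v :&: A)) t)%:R
    + (quiet (own (nbr U v :&: A)) t)%:R * pot (nbr U v :&: surviving U A t))
  <= pot (nbr U v :&: A) + 2 * M ^+ 2 * p ^+ 2.
Proof.
move=> deg vU; set B := nbr U v :&: A.
have BU : B \subset U.
  by apply/subsetP => u; rewrite !inE => /andP[/andP[]].
have Bm : (#|B| <= m)%N.
  by rewrite (leq_trans _ (deg v vU)) // subset_leq_card // subsetIl.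
have M0 : 0 < M by rewrite ltr0n.
have BM : #|B|%:R <= M by rewrite ler_nat leqW.
(* The number of killers of [u] that are not activation bits of [B]. *)
pose kap u : nat := (m - #|nbr U u :&: B|)%N.
have kapE u : u \in B -> (kap u)%:R = M - #|B|%:R + pairs_at R adj B u.
  move=> uB.
  have dB : (#|nbr U u :&: B| <= m)%N.
    by rewrite (leq_trans _ Bm) // subset_leq_card // subsetIr.
  rewrite (pairs_at_nbr BU uB).
  rewrite /kap natrB // -[m.+1]addn1 natrD; ring.
have cardBK u : u \in B -> #|own B :|: killers U u| = (#|B| + kap u)%N.
  move=> uB; have uU := subsetP BU _ uB.
  rewrite card_own_killers ?deg // setUC cardsU /kap.
  have : (#|nbr U u :&: B| <= #|nbr U u|)%N.
    by rewrite subset_leq_card // subsetIl.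
  have := deg u uU; have : (#|nbr U u :&: B| <= #|B|)%N.
    by rewrite subset_leq_card // subsetIr.
  lia.
pose K (t : step) := [set u in B | ~~ quiet (killers U u) t].
pose D u := dpot adj M B u.
pose N (u : I) : {set I * 'I_m.+1} := own B :|: killers U u.
have D0 u : 0 <= D u by exact: dpot_ge0.
(* The difference of the two indicators says that [B] stays quiet while [u] is killed from
   outside. *)
have pt (t : step) : (~~ quiet (own B) t)%:R
    + (quiet (own B) t)%:R * pot (nbr U v :&: surviving U A t)
  <= 1 - (quiet (own B) t)%:R * (1 - pot B)
     - \sum_(u in B) D u * ((quiet (own B) t)%:R - (quiet (N u) t)%:R).
  case: (boolP (quiet (own B) t)) => qB; last first.
    rewrite /= mul0r addr0 mul0r subr0 lerBrDl big1 ?add0r // => u uB.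
    by rewrite /N quietU (negbTE qB) subrr mulr0.
  have -> : nbr U v :&: surviving U A t = B :\: K t.
    apply/setP => u.
    have eB : (u \in B) = (u \in nbr U v) && (u \in A) by rewrite in_setI.
    have eK : (u \in K t) = (u \in B) && ~~ quiet (killers U u) t by rewrite inE.
    have eS : (u \in surviving U A t)
      = [&& u \in A, t (u, ord0) != ord0 & quiet (killers U u) t] by rewrite inE.
    rewrite in_setD eK in_setI eS andbA -eB.
    case: (boolP (u \in B)) => //= uB; rewrite negbK andbT.
    have -> //: t (u, ord0) != ord0.
    by move/forall_inP: qB; apply; rewrite /own in_set /= uB eqxx.
  have KB : K t \subset B by apply/subsetP => u; rewrite inE => /andP[].
  rewrite /= add0r !mul1r subKr.
  apply: le_trans (potDset adjC _ BM KB) _ => //.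
  rewrite lerD2l lerN2 [leLHS](big_setID (K t)) /= (setIidPr KB).
  rewrite [X in _ + X <= _]big1 => [|u]; last first.
    rewrite in_setD inE => /andP[+ uB]; rewrite uB negbK => ku.
    by rewrite /N quietU qB ku subrr mulr0.
  rewrite addr0 ler_sum // => u uK.
  rewrite /N quietU qB; move: uK; rewrite inE => /andP[_ /negbTE ->].
  by rewrite subr0 mulr1.
apply: le_trans (le_expect pt) _.
have step0 : (0 < #|{: step}|)%N by rewrite card_ffun card_ord expn_gt0.
have p0 : 0 <= p by rewrite subr_ge0.
pose X := \sum_(u in B) (kap u)%:R * D u.
have XM : X <= M.
  rewrite -[leRHS]mulr1; apply: le_trans (ler_wpM2l (ltW M0) (sum_dpot_le _ M0 BM)).
  rewrite mulr_sumr; apply: ler_sum => u _; apply: (ler_wpM2r (D0 u)).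
  by rewrite ler_nat (leq_trans (leq_subr _ _)).
have genX : #|B|%:R * (1 - pot B) <= X.
  apply: le_trans (pot_generator adjC M0 BM) _.
  by apply: ler_sum => u uB; rewrite kapE.
have -> : expect (fun t : step => 1 - (quiet (own B) t)%:R * (1 - pot B)
     - \sum_(u in B) D u * ((quiet (own B) t)%:R - (quiet (N u) t)%:R))
  = 1 - rho ^+ #|B| * (1 - pot B)
    - \sum_(u in B) D u * (rho ^+ #|B| - rho ^+ (#|B| + kap u)).
  rewrite !expectB expect_cst // expect_sum; congr (_ - _ - _).
    rewrite -(card_own B) -prob_quiet mulrC /prob -expectZ.
    by apply: eq_expect => t; rewrite mulrC.
  apply: eq_bigr => u uB; rewrite expectZ expectB -cardBK // -(card_own B).
  by rewrite -!prob_quiet.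
(* First-order expansion: rho^|B| (1 - rho^kap) is at least kap p rho^(|B| + kap), and the exponent
   |B| + kap is at most 2M. *)
have sumge : p * X - 2 * M * p ^+ 2 * X
    <= \sum_(u in B) D u * (rho ^+ #|B| - rho ^+ (#|B| + kap u)).
  have -> : p * X - 2 * M * p ^+ 2 * X
          = \sum_(u in B) D u * ((kap u)%:R * p * (1 - 2 * M * p)).
    rewrite -mulrBl /X mulr_sumr; apply: eq_bigr => u _; ring.
  apply: ler_sum => u uB; rewrite ler_wpM2l // exprD.
  have -> (x y : R) : x - x * y = x * (1 - y) by ring.
  apply: le_trans (ler_wpM2l (exprn_ge0 _ rho_ge0)
                     (exprn_Bernoulli_rev' rho_ge0 rho_le1 (kap u))).
  rewrite mulrCA -exprD ler_wpM2l ?mulr_ge0 //.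
  have := exprn_Bernoulli rho_ge0 rho_le1 (#|B| + kap u).
  have : (#|B| + kap u)%:R * p <= 2 * M * p.
    rewrite ler_wpM2r // -natrM ler_nat; have := leq_subr #|nbr U u :&: B| m.
    by rewrite -/(kap u); lia.
  lra.
have := exprn_Bernoulli rho_ge0 rho_le1 #|B|.
have P1 : 0 <= 1 - pot B by rewrite subr_ge0 pot_le1.
move/(ler_wpM2r P1) => h1.
have h2 := ler_wpM2l p0 genX.
have h3 : 2 * M * p ^+ 2 * X <= 2 * M * p ^+ 2 * M.
  by rewrite ler_wpM2l ?mulr_ge0 ?exprn_ge0.
move: sumge; set S := \sum_(u in B) D u * _ => sumge.
clear XM genX; move: sumge h1 h2 h3; move: S X (rho ^+ #|B|) (pot B) => S X' y z; lra.
Qed.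

(** Supermartingale argument: [pot] is nonnegative at the end, and each of the [l] steps adds the
    error of [pot_step]. *)
Lemma prob_blocked U v l : (forall u, u \in U -> (#|nbr U u| <= m)%N) ->
  v \in U -> forall A,
  prob R [pred w : power step l | ~~ [disjoint nbr U v & entered U A w]]
    <= pot (nbr U v :&: A) + l%:R * (2 * M ^+ 2 * p ^+ 2).
Proof.
move=> deg vU; elim: l => [|l IH] A.
  rewrite /prob expect_unit /= disjoints_subset setC0 subsetT mul0r addr0.
  apply: pot_ge0; rewrite ?ltr0n // ler_nat leqW // (leq_trans _ (deg v vU)) //.
  by rewrite subset_leq_card // subsetIl.
rewrite /prob expect_prod.
have step0 : (0 < #|{: step}|)%N by rewrite card_ffun card_ord expn_gt0.
apply: (@le_trans _ _ (expect (fun t : step =>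
    ((~~ quiet (own (nbr U v :&: A)) t)%:R
    + (quiet (own (nbr U v :&: A)) t)%:R * pot (nbr U v :&: surviving U A t))
    + l%:R * (2 * M ^+ 2 * p ^+ 2)))).
  apply: le_expect => t.
  case: (boolP (quiet (own (nbr U v :&: A)) t)) => qB.
    rewrite /= add0r mul1r; apply: le_trans (IH _); apply: le_expect => w /=.
    rewrite ler_nat; case: (boolP (~~ _)) => // /pred0Pn[u /andP[/= uv]].
    rewrite /= in_setU => /orP[ue|ue].
      move: ue; rewrite inE => /and3P[uA tu _]; move/forall_inP: qB => /(_ (u, ord0)).
      by rewrite inE in_setI /= uv uA eqxx tu => /(_ isT).
    by rewrite lt0b; apply/pred0Pn; exists u; apply/andP.
  rewrite /= mul0r addr0; apply: (@le_trans _ _ 1); last first.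
    by rewrite lerDl mulr_ge0 // !mulr_ge0 ?exprn_ge0 // subr_ge0.
  rewrite -[leRHS](@expect_cst R (power step l)) ?card_power_gt0 //.
  by apply: le_expect => w; rewrite lern1 leq_b1.
rewrite expectD expect_cst //.
have := pot_step A deg vU; set c := 2 * _ * _ => h.
have -> : pot (nbr U v :&: A) + l.+1%:R * c = pot (nbr U v :&: A) + c + l%:R * c.
  by rewrite -natr1; ring.
by rewrite lerD2r.
Qed.

(** * Repeated stages *)

Definition remaining U S : {set I} :=
  [set e in U | (e \notin S) && [disjoint nbr U e & S]].

Fixpoint staged n U : power (power step L) n -> {set I} :=
  if n is n'.+1 then fun w =>
    entered U U w.1 :|: staged (remaining U (entered U U w.1)) w.2
  else fun _ => set0.

Lemma remaining_sub U S : remaining U S \subset U.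
Proof. by apply/subsetP => e; rewrite inE => /andP[]. Qed.

Lemma staged_sub n U (w : power (power step L) n) : staged U w \subset U.
Proof.
elim: n U w => [|n IH] U w /=; first exact: sub0set.
by rewrite subUset entered_sub (subset_trans (IH _ _)) // remaining_sub.
Qed.

Lemma staged_indep n U (w : power (power step L) n) :
  {in staged U w &, forall u v, ~~ adj u v}.
Proof.
elim: n U w => [|n IH] U w u v /=; first by rewrite inE.
have cross x y : x \in entered U U w.1 ->
    y \in staged (remaining U (entered U U w.1)) w.2 -> ~~ adj y x.
  move=> xE /(subsetP (staged_sub _ _)); rewrite inE => /and3P[yU _ dis].
  apply: contraTN xE => yx; apply/negP => xE.
  by move: (disjointFl dis xE); rewrite inE yx (subsetP (entered_sub _ _ _) _ xE).
rewrite !in_setU => /orP[uE|uL] /orP[vE|vL].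
- exact: entered_indep uE vE.
- by rewrite adjC; exact: cross.
- exact: cross.
- exact: IH uL vL.
Qed.

(** Either [v] remains, or it is blocked, or it has entered; the last case costs the term 1/M. *)
Lemma prob_remaining U v (b : R) :
  (forall u, u \in U -> (#|nbr U u| <= m)%N) -> v \in U ->
  pot (nbr U v) + L%:R * (2 * M ^+ 2 * p ^+ 2) + M^-1 <= b ->
  1 - b <= prob R [pred w : power step L | v \in remaining U (entered U U w)].
Proof.
move=> deg vU leb; rewrite lerBlDr.
apply: (@le_trans _ _ (prob R [pred w : power step L |
    v \in remaining U (entered U U w)]
  + (prob R [pred w : power step L | ~~ [disjoint nbr U v & entered U U w]]
  + prob R [pred w : power step L | v \in entered U U w]))); last first.
  rewrite lerD2l; apply: le_trans leb; apply: lerD; last first.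
    by rewrite prob_entered ?deg // enter_prob_le.
  have := prob_blocked L deg vU U; rewrite (setIidPl _) //.
  by apply/subsetP => u; rewrite inE => /andP[].
have step0 : (0 < #|{: step}|)%N by rewrite card_ffun card_ord expn_gt0.
rewrite /prob -!expectD -[leLHS](@expect_cst R (power step L)) ?card_power_gt0 //.
apply: le_expect => w /=; rewrite inE vU /= -!natrD ler1n.
by case: (v \in _); case: [disjoint _ & _].
Qed.

(** The set of free edges after a stage is random, so the bound on the potential is asked for all
    [U] inside [F]. An edge still free with probability at least 1 - b gets a fresh chance, which
    turns a sum s into 1 + (1 - b) s. *)
Lemma prob_staged n (F : {set I}) (b : R) :
  (forall u, u \in F -> (#|nbr F u| <= m)%N) -> b <= 1 ->
  (forall U v, U \subset F -> v \in U ->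
     pot (nbr U v) + L%:R * (2 * M ^+ 2 * p ^+ 2) + M^-1 <= b) ->
  forall U e, U \subset F -> e \in U ->
  enter_prob L * \sum_(j < n) (1 - b) ^+ j
    <= prob R [pred w : power (power step L) n | e \in staged U w].
Proof.
move=> degF b1 potF; elim: n => [|n IH] U e UF eU.
  by rewrite big_ord0 mulr0 prob_ge0.
have degU u : u \in U -> (#|nbr U u| <= m)%N.
  move=> uU; apply: leq_trans (degF u _); last exact: (subsetP UF).
  rewrite subset_leq_card //; apply/subsetP => z.
  by rewrite !inE => /andP[/(subsetP UF) -> ->].
have ent0 : 0 <= enter_prob L by rewrite -(prob_entered L eU (degU _ eU)) prob_ge0.
have step0 : (0 < #|{: step}|)%N by rewrite card_ffun card_ord expn_gt0.
set s := \sum_(j < n) (1 - b) ^+ j.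
have s0 : 0 <= s by apply: sumr_ge0 => j _; rewrite exprn_ge0 // subr_ge0.
have -> : \sum_(j < n.+1) (1 - b) ^+ j = 1 + (1 - b) * s.
  rewrite big_ord_recl expr0 /s mulr_sumr; congr (_ + _).
  by apply: eq_bigr => j _; rewrite -exprS.
rewrite mulrDr mulr1 mulrCA.
have rem := prob_remaining degU eU (potF _ _ UF eU).
apply: (@le_trans _ _ (enter_prob L
  + prob R [pred w : power step L | e \in remaining U (entered U U w)]
    * (enter_prob L * s))).
  by rewrite lerD2l ler_wpM2r // mulr_ge0.
rewrite -[X in X + _](prob_entered L eU (degU _ eU)) mulrC /prob -expectZ -expectD.
rewrite [leRHS]expect_prod; apply: le_expect => w /=.
case: (boolP (e \in remaining _ _)) => er.
  have eE : (e \in entered U U w) = false.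
    by move: er; rewrite inE => /and3P[_ /negbTE].
  rewrite eE add0r mulr1; apply: le_trans (IH _ _ _ er) _.
    exact: subset_trans (remaining_sub _ _) UF.
  by apply: le_expect => w' /=; rewrite in_setU eE.
rewrite mulr0 addr0.
rewrite -[leLHS](@expect_cst R (power (power step L) n)) ?card_power_gt0 //.
by apply: le_expect => w' /=; rewrite in_setU ler_nat; case: (_ \in entered _ _ _).
Qed.

(** * Locality of the random matching *)

Definition closed_nbr F u : {set I} := u |: nbr F u.

Fixpoint ball F r e : {set I} :=
  if r is r'.+1 then \bigcup_(f in ball F r' e) closed_nbr F f else [set e].

Lemma ball_closed_nbr F r e f : f \in ball F r e ->
  closed_nbr F f \subset ball F r.+1 e.
Proof. by move=> fB; apply: bigcup_sup. Qed.

Lemma ballS F r e : ball F r e \subset ball F r.+1 e.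
Proof.
apply/subsetP => f /ball_closed_nbr /subsetP; apply; exact: setU11.
Qed.

Lemma ball_center F r e : e \in ball F r e.
Proof. by elim: r => [|r /(subsetP (ballS _ _ _))]; rewrite ?inE. Qed.

Definition step_space : local_space I step :=
  @table_space I _ 'I_q.+1 (fun x : I * 'I_m.+1 => x.1).

Lemma killers_fst U F u x : U \subset F -> x \in killers U u ->
  x.1 \in closed_nbr F u.
Proof.
move=> UF; rewrite !inE => /orP[/andP[/andP[xU ux] _]|/andP[-> //]].
by rewrite ux (subsetP UF _ xU) orbT.
Qed.

Lemma nbr_local F U U' e : U \subset F -> U' \subset F ->
  {in closed_nbr F e, U =i U'} -> nbr U e = nbr U' e.
Proof.
move=> UF UF' UU'; apply/setP => z; rewrite !inE.
case: (boolP (adj e z)) => ez; rewrite ?andbF // !andbT.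
case: (boolP (z \in F)) => zF; first by apply: UU'; rewrite !inE zF ez orbT.
by rewrite !(contraNF (subsetP _ z) zF).
Qed.

(** Radius 1 suffices for any number of steps, because killers act whether or not they are alive. *)
Lemma entered_local F l U U' A A' (S : {set I}) e (w w' : power step l) :
  U \subset F -> U' \subset F -> {in closed_nbr F e, U =i U'} ->
  closed_nbr F e \subset S -> agree (power_space step_space l) S w w' ->
  (e \in A) = (e \in A') ->
  (e \in entered U A w) = (e \in entered U' A' w').
Proof.
move=> UF UF' UU' eS; elim: l A A' w w' => [|l IH] A A' w w'.
  by rewrite /= !inE.
case=> /= agr agr' eA.
have kE : killers U e = killers U' e.
  by rewrite /killers (nbr_local UF UF' UU').
have qE : quiet (killers U e) w.1 = quiet (killers U' e) w'.1.
  rewrite -kE; apply: eq_forallb_in => x /(killers_fst UF) xe.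
  by rewrite agr // (subsetP eS).
have oE : w.1 (e, ord0) = w'.1 (e, ord0).
  by apply: agr; rewrite (subsetP eS) // setU11.
rewrite !in_setU; congr (_ || _); first by rewrite !inE eA oE qE.
by apply: IH => //; rewrite !inE eA oE qE.
Qed.

(** A stage costs two units of radius: whether f remains depends on which of its neighbours entered,
    and this on their closed neighbourhoods. *)
Lemma staged_local F n U U' (S : {set I}) e (w w' : power (power step L) n) :
  U \subset F -> U' \subset F -> {in ball F (2 * n) e, U =i U'} ->
  ball F (2 * n) e \subset S ->
  agree (power_space (power_space step_space L) n) S w w' ->
  (e \in staged U w) = (e \in staged U' w').
Proof.
elim: n U U' w w' => [|n IH] U U' w w' UF UF' UU' eS; first by rewrite /= !inE.
rewrite mulnS add2n in UU' eS; case=> /= agr agr'.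
have entE f : f \in ball F (2 * n).+1 e ->
    (f \in entered U U w.1) = (f \in entered U' U' w'.1).
  move=> fB; apply: (@entered_local F _ _ _ _ _ S) => //.
  - by move=> z /(subsetP (ball_closed_nbr fB)) /UU'.
  - exact: subset_trans (ball_closed_nbr fB) eS.
  - exact/UU'/(subsetP (ballS _ _ _)).
rewrite !in_setU entE ?ball_center //; congr (_ || _).
apply: IH => //.
- exact: subset_trans (remaining_sub _ _) UF.
- exact: subset_trans (remaining_sub _ _) UF'.
- move=> f fB; have fB1 := subsetP (ballS _ _ _) _ fB.
  have fB2 := subsetP (ballS _ _ _) _ fB1.
  rewrite !inE UU' // entE //; congr [&& _, _ & _].
  have -> : nbr U f = nbr U' f.
    apply: (nbr_local UF UF') => z /(subsetP (ball_closed_nbr fB)) zB.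
    exact/UU'/(subsetP (ballS _ _ _)).
  rewrite -!setI_eq0; congr (_ == _); apply/setP => z; rewrite !in_setI.
  case: (boolP (z \in nbr U' f)) => //= zf; apply: entE.
  apply: (subsetP (ball_closed_nbr fB)); move: zf; rewrite !inE => /andP[zU ->].
  by rewrite (subsetP UF') ?orbT.
- apply: subset_trans eS; exact: subset_trans (ballS _ _ _) (ballS _ _ _).
Qed.
End Process.

(** * Choice of the parameters of the process *)

Lemma exprn_le_inv (R : realFieldType) (r : R) n : 0 <= r -> r <= 1 ->
  r ^+ n <= (1 + n%:R * (1 - r))^-1.
Proof.
move=> r0 r1.
have h : 0 < 1 + n%:R * (1 - r) by rewrite ltr_pwDl // mulr_ge0 // subr_ge0.
rewrite -[leRHS]mul1r ler_pdivlMr //.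
by have := exprn_Bernoulli_rev' r0 r1 n; lra.
Qed.

Lemma exprn_archi (R : realType) (r d : R) : 0 <= r -> r < 1 -> 0 < d ->
  exists n, r ^+ n <= d.
Proof.
move=> r0 r1 d0.
have c0 : 0 < d * (1 - r) by rewrite mulr_gt0 // subr_gt0.
exists (Num.bound (d * (1 - r))^-1); set n := Num.bound _.
have nP : (d * (1 - r))^-1 < n%:R.
  by rewrite /n; apply: archi_boundP; rewrite invr_ge0 ltW.
apply: le_trans (exprn_le_inv n r0 (ltW r1)) _.
rewrite -[leRHS]invrK lef_pV2 ?posrE ?invr_gt0 //; last first.
  by rewrite ltr_pwDl // mulr_ge0 // subr_ge0 ltW.
rewrite -[d^-1]mul1r ler_pdivrMr //.
move: nP; rewrite -[X in X < _]mul1r ltr_pdivrMr //; nra.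
Qed.

Lemma geom_sum (R : realFieldType) (b : R) n : 0 < b ->
  \sum_(j < n) (1 - b) ^+ j = (1 - (1 - b) ^+ n) / b.
Proof.
move=> b0; elim: n => [|n IH]; first by rewrite big_ord0 expr0 subrr mul0r.
rewrite big_ord_recr /= IH exprS; field; exact: lt0r_neq0.
Qed.

(** The number [n] of stages, which determines the radius of dependence, is fixed before the graph
    and depends on [b0] and [d] only; [q] and [L] may grow with m. *)
Lemma staged_prob_ge (R : realType) (b0 d : R) : 0 < b0 -> b0 < 1 -> 0 < d ->
  exists n, forall (I : finType) (adj : rel I), symmetric adj -> irreflexive adj ->
  forall (m : nat) (F : {set I}) (b : R),
  4 <= d * m.+1%:R ->
  (forall u, u \in F -> (#|nbr adj F u| <= m)%N) -> b0 <= b -> b <= 1 ->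
  (forall (U : {set I}) v, U \subset F -> v \in U ->
     pot adj m.+1%:R (nbr adj U v) + 2 / m.+1%:R <= b) ->
  exists q L, forall e, e \in F ->
    (1 - d) / (b * m.+1%:R)
    <= prob R [pred w : power (power (step I m q) L) n | e \in staged adj F w].
Proof.
move=> b00 b01 d0.
have [n nP] : exists n, (1 - b0) ^+ n <= d / 2.
  by apply: exprn_archi; lra.
exists n => I adj adjC adjxx m F b dm deg b0b b1 potF.
set M : R := m.+1%:R.
have M1 : 1 <= M by rewrite ler1n.
(* With N steps and activation probability 1/N the accumulated error 2 M^2 / N is 1/M. Together with
   the 1/M for entering this gives 2/M, and a vertex survives all steps with probability at most
   1/M. *)
pose N := (2 * m.+1 ^ 3)%N.
have N0 : (0 < N)%N by rewrite muln_gt0 expn_gt0.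
have NR : N%:R = 2 * M ^+ 3 :> R by rewrite natrM natrX.
(* A bit has [q.+1] = N values. *)
exists N.-1, N => e eF.
pose rho : R := N.-1%:R / N.-1.+1%:R.
have rhoE : 1 - rho = N%:R^-1.
  rewrite /rho prednK // -[N in N.-1]prednK //= -{1 2}(prednK N0) -natr1.
  by field; rewrite natr1 pnatr_eq0.
have M0 : 0 < M by rewrite ltr0n.
have NR0 : 0 < N%:R :> R by rewrite ltr0n.
have rho0 : 0 <= rho by rewrite divr_ge0.
have rho1 : rho <= 1 by rewrite -subr_ge0 rhoE invr_ge0 ltW.
have bpos : 0 < b := lt_le_trans b00 b0b.
have hyp (U : {set I}) v : U \subset F -> v \in U ->
    pot adj M (nbr adj U v) + N%:R * (2 * M ^+ 2 * (1 - rho) ^+ 2) + M^-1 <= b.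
  move=> UF vU; apply: le_trans (potF U v UF vU); rewrite -addrA lerD2l rhoE NR.
  have -> : 2 * M ^+ 3 * (2 * M ^+ 2 * (2 * M ^+ 3)^-1 ^+ 2) + M^-1 = 2 / M.
    by field; rewrite addrC natr1 pnatr_eq0.
  exact: lexx.
have := prob_staged adjC adjxx n deg b1 hyp (subxx F) eF.
apply: le_trans; rewrite geom_sum //.
have x1 : 1 - M^-1 <= rho ^+ m.
  have := exprn_Bernoulli rho0 rho1 m; rewrite rhoE => h.
  rewrite lerBlDr addrC -lerBlDr; apply: le_trans h _.
  rewrite ler_pdivrMr // NR.
  have -> : M^-1 * (2 * M ^+ 3) = 2 * M ^+ 2.
    by field; rewrite addrC natr1 pnatr_eq0.
  have : m%:R <= M by rewrite ler_nat.
  by move: (M) M1 => x; nra.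
have y1 : rho ^+ m.+1 ^+ N <= M^-1.
  rewrite -exprM; apply: le_trans (exprn_le_inv _ rho0 rho1) _.
  rewrite rhoE natrM mulfK ?lt0r_neq0 // lef_pV2 ?posrE //; last first.
    by rewrite ltr_pwDl ?ltr01 // ltW.
  by rewrite lerDr.
have y0 : 0 <= rho ^+ m.+1 ^+ N by rewrite !exprn_ge0.
have ent : (1 - 2 / M) / M <= enter_prob R m N.-1 N.
  apply: le_trans (enter_prob_ge _ _ _ _); rewrite -/rho mulrAC.
  rewrite ler_wpM2r ?invr_ge0 ?(ltW M0) //.
  have Mi1 : M^-1 <= 1 by rewrite invf_le1.
  move: x1 y1 y0; move: (rho ^+ m) (_ ^+ N) (M^-1) Mi1 => x y i *; nra.
have t1 : (1 - b) ^+ n <= d / 2.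
  apply: le_trans nP; rewrite lerXn2r ?nnegrE ?subr_ge0 ?(ltW b01) //.
  by rewrite lerD2l lerN2.
have t0 : 0 <= 1 - (1 - b) ^+ n.
  by rewrite subr_ge0 exprn_ile1 ?subr_ge0 // lerBlDr lerDl ltW.
apply: le_trans (ler_wpM2r _ ent); last by rewrite divr_ge0 // ltW.
have -> : (1 - 2 / M) / M * ((1 - (1 - b) ^+ n) / b)
        = (1 - 2 / M) * (1 - (1 - b) ^+ n) / (b * M).
  by rewrite mulf_div [M * b]mulrC.
rewrite ler_wpM2r ?invr_ge0 ?mulr_ge0 ?(ltW M0) ?(ltW bpos) //.
have : 2 / M <= d / 2 by rewrite ler_pdivrMr //; move: dm; rewrite -/M; lra.
have : 0 <= 2 / M by rewrite divr_ge0 // ltW.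
have : 0 <= (1 - b) ^+ n by rewrite exprn_ge0 // subr_ge0.
move: t1 t0; move: ((1 - b) ^+ n) (2 / M) => x y; nra.
Qed.

(** * Colouring most edges by independent matchings *)

Section Covering.
Variables (R : realType) (I T : finType) (mu : T -> {set I}).

Fixpoint covered c : power T c -> {set I} :=
  if c is c'.+1 then fun w => mu w.1 :|: covered w.2 else fun _ => set0.

(** Exponential moment of the number of uncovered edges: while more than z of them are left, each
    matching multiplies it by at most 1 - (1 - 1/W) Q z, which is at most the exponential on the
    right. *)
Lemma expect_uncovered (S : {set I}) (Q W : R) z c :
  (forall t, (#|S :&: mu t| <= 1)%N) ->
  (forall e, e \in S -> Q <= prob R [pred t | e \in mu t]) ->
  0 <= Q -> 1 <= W -> (0 < #|T|)%N ->
  expect (fun w : power T c =>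
    W ^+ #|S :\: covered w| * (z < #|S :\: covered w|)%N%:R)
  <= W ^+ #|S| * expR (- ((1 - W^-1) * (Q * z%:R))) ^+ c.
Proof.
move=> + + Q0 W1 T0; have W0 : 0 < W := lt_le_trans ltr01 W1.
have g0 : 0 <= 1 - W^-1 by rewrite subr_ge0 invf_le1.
elim: c S => [|c IH] S S1 SQ.
  rewrite expect_unit /= setD0 expr0 mulr1 ler_piMr ?exprn_ge0 ?(ltW W0) //.
  by rewrite lern1 leq_b1.
set y := (1 - W^-1) * _; rewrite expect_prod.
(* The uncovered set only shrinks, so with at most z edges left the indicator stays 0. *)
have [Sz|zS] := leqP #|S| z.
  rewrite (@le_trans _ _ 0) ?mulr_ge0 ?exprn_ge0 ?expR_ge0 ?(ltW W0) //.
  rewrite -[leRHS](@expect_cst R T) //; apply: le_expect => t.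
  rewrite -[leRHS](@expect_cst R (power T c)) ?card_power_gt0 //.
  apply: le_expect => w; rewrite ltnNge (leq_trans _ Sz) ?mulr0 //.
  by rewrite subset_leq_card // subsetDl.
apply: (@le_trans _ _ (expect (fun t : T =>
    W ^+ #|S| * expR (- y) ^+ c
    * (1 - (1 - W^-1) * \sum_(e in S) (e \in mu t)%:R)))).
  apply: le_expect => t.
  (* A matching takes at most one edge of [S], so the power of W is affine in the indicator. *)
  have -> : W ^+ #|S| * expR (- y) ^+ c
      * (1 - (1 - W^-1) * \sum_(e in S) (e \in mu t)%:R)
    = W ^+ #|S :\: mu t| * expR (- y) ^+ c.
    have -> : \sum_(e in S) (e \in mu t)%:R = #|S :&: mu t|%:R :> R.
      rewrite -sum1_card natr_sum [in LHS]big_mkcond [in RHS]big_mkcond /=.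
      by apply: eq_bigr => e _; rewrite in_setI; case: (e \in S); case: (e \in mu t).
    rewrite -(cardsID (mu t) S); move: (S1 t); case: #|_ :&: _| => [|[|//]] _.
      by rewrite mulr0 subr0 mulr1.
    rewrite mulr1 subKr add1n exprS.
    by move: (W ^+ _) (expR _ ^+ _) => x x'; field; exact: lt0r_neq0.
  apply: le_trans (IH (S :\: mu t) _ _) => [|t'|e].
  - by apply: le_expect => w /=; rewrite setDDl.
  - apply: leq_trans (S1 t'); apply: subset_leq_card.
    by rewrite setSI // subsetDl.
  - by rewrite inE => /andP[_ /SQ].
rewrite expectZ exprSr mulrA ler_wpM2l ?mulr_ge0 ?exprn_ge0 ?expR_ge0 ?(ltW W0) //.
apply: le_trans (expR_ge1Dx (- y)).
rewrite expectB expect_cst // expectZ expect_sum lerD2l lerN2 ler_wpM2l //.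
apply: le_trans (_ : \sum_(e in S) Q <= _); last exact: ler_sum.
by rewrite sumr_const -[Q *+ _]mulr_natr ler_wpM2l // ler_nat ltnW.
Qed.

(** Markov's inequality for this moment. *)
Lemma prob_uncovered (S : {set I}) (Q W : R) z c :
  (forall t, (#|S :&: mu t| <= 1)%N) ->
  (forall e, e \in S -> Q <= prob R [pred t | e \in mu t]) ->
  0 <= Q -> 1 <= W -> (0 < #|T|)%N ->
  W ^+ z * prob R [pred w : power T c | z < #|S :\: covered w|]%N
  <= W ^+ #|S| * expR (- ((1 - W^-1) * (Q * z%:R))) ^+ c.
Proof.
move=> S1 SQ Q0 W1 T0; apply: le_trans (expect_uncovered z c S1 SQ Q0 W1 T0).
rewrite /prob -expectZ; apply: le_expect => w /=.
case: ltnP => h; last by rewrite !mulr0.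
by rewrite !mulr1 ler_weXn2l // ltnW.
Qed.
End Covering.

(** * Combining colourings, greedy colouring *)

Section Colouring.
Variables (I : finType) (adj : rel I).
Hypotheses (adjC : symmetric adj) (adjxx : irreflexive adj).
Implicit Types A B F : {set I}.

Definition colorable F n := exists c : I -> nat,
  (forall e, e \in F -> (c e < n)%N) /\
  {in F &, forall e f, adj e f -> c e <> c f}.

Lemma colorable_sub A B n : A \subset B -> colorable B n -> colorable A n.
Proof.
move=> /subsetP AB [c [cn cB]]; exists c; split=> [e /AB|e f /AB eB /AB fB].
  exact: cn.
exact: cB.
Qed.

Lemma colorableU A B n n' :
  colorable A n -> colorable B n' -> colorable (A :|: B) (n + n').
Proof.
case=> [c [cn cA]] [c' [cn' cB]].
exists (fun e => if e \in A then c e else (n + c' e)%N); split=> [e|e f].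
  by rewrite inE; case: ifP => [/cn ce _|_ /cn' ce]; lia.
rewrite !inE; case: ifP => eA; case: ifP => fA //= eB fB.
- exact: cA.
- by move=> _ h; have := cn e eA; lia.
- by move=> _ h; have := cn f fA; lia.
- by move=> ef h; apply: (cB e f eB fB ef); lia.
Qed.

Lemma colorable_indep A : {in A &, forall e f, ~~ adj e f} -> colorable A 1.
Proof.
move=> indA; exists (fun=> 0%N); split=> // e f eA fA ef.
by have := indA e f eA fA; rewrite ef.
Qed.

Lemma colorable_covered (T : finType) (mu : T -> {set I}) c (w : power T c) :
  (forall t, {in mu t &, forall e f, ~~ adj e f}) -> colorable (covered mu w) c.
Proof.
move=> ind; elim: c w => [|c IH] w /=.
  by exists (fun=> 0%N); split=> [e|e f]; rewrite inE.
by rewrite -add1n; apply: colorableU (IH _); exact: colorable_indep.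
Qed.

Lemma colorable_greedy F n :
  (forall e, e \in F -> (#|nbr adj F e| < n)%N) -> colorable F n.
Proof.
move: {2}#|F| (erefl #|F|) => s; elim: s F => [|s IH] F.
  move/eqP; rewrite cards_eq0 => /eqP -> _.
  by exists (fun=> 0%N); split=> [e|e f]; rewrite inE.
move=> cF deg; have /card_gt0P[e eF] : (0 < #|F|)%N by rewrite cF.
have [||c [cn cF']] := IH (F :\ e).
- by move: cF; rewrite (cardsD1 e) eF => -[].
- move=> f; rewrite inE => /andP[_ fF]; apply: leq_ltn_trans (deg f fF).
  by apply: subset_leq_card; apply/subsetP => z; rewrite !inE => /andP[/andP[_ ->]].
pose used : {set 'I_n} := 
    [set i : 'I_n | [exists z in nbr adj F e, c z == i :> nat]].
have /card_gt0P[i] : (0 < #|~: used|)%N.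
  rewrite cardsCs setCK card_ord subn_gt0; apply: leq_ltn_trans (deg e eF).
  have n0 : (0 < n)%N by apply: leq_ltn_trans (deg e eF).
  apply: leq_trans (leq_imset_card (fun z => odflt (Ordinal n0) (insub (c z))) _).
  apply/subset_leq_card/subsetP => i; rewrite inE => /exists_inP[z zN /eqP ci].
  by apply/imsetP; exists z => //; rewrite ci valK.
rewrite !inE negb_exists_in => /forall_inP iP.
exists (fun z => if z == e then i : nat else c z); split=> [z zF|z z' zF z'F].
  by case: eqVneq => [//|ze]; apply: cn; rewrite !inE ze.
case: eqVneq => [->|ze]; case: eqVneq => [->|z'e] zz'.
- by rewrite adjxx in zz'.
- by move=> ci; have := iP z'; rewrite inE z'F zz' ci eqxx => /(_ isT).
- by move=> ci; have := iP z; rewrite inE zF adjC zz' ci eqxx => /(_ isT).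
- by apply: cF'; rewrite ?inE ?ze ?z'e.
Qed.
End Colouring.

(** * Sizes of balls *)

Section Balls.
Variables (I : finType) (adj : rel I) (m : nat) (F : {set I}).
Hypothesis adjC : symmetric adj.
Hypothesis deg : forall e, e \in F -> (#|nbr adj F e| <= m)%N.

Lemma card_bigcup_le (J J' : finType) (A : {set J}) (B : J -> {set J'}) n :
  (forall j, j \in A -> (#|B j| <= n)%N) ->
  (#|\bigcup_(j in A) B j| <= #|A| * n)%N.
Proof.
move=> Bn; rewrite -sum_nat_const.
apply: (@leq_trans (\sum_(j in A) #|B j|)); last exact: leq_sum.
elim/big_rec2: _ => [|j s S _ IH]; first by rewrite cards0.
by rewrite (leq_trans (leq_card_setU _ _)) // leq_add2l.
Qed.

Lemma card_closed_nbr e : e \in F -> (#|closed_nbr adj F e| <= m.+1)%N.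
Proof.
move=> eF; apply: leq_trans (leq_card_setU _ _) _.
by rewrite cards1 add1n ltnS deg.
Qed.

Lemma closed_nbr_sub e : e \in F -> closed_nbr adj F e \subset F.
Proof.
move=> eF; rewrite subUset sub1set eF.
by apply/subsetP => z; rewrite inE => /andP[].
Qed.

Lemma ball_sub r e : e \in F -> ball adj F r e \subset F.
Proof.
move=> eF; elim: r => [|r /subsetP IH]; first by rewrite sub1set.
by apply/bigcupsP => f /IH; exact: closed_nbr_sub.
Qed.

Lemma card_ball r e : e \in F -> (#|ball adj F r e| <= m.+1 ^ r)%N.
Proof.
move=> eF; elim: r => [|r IH]; first by rewrite cards1.
apply: leq_trans (card_bigcup_le (n := m.+1) _) _.
  by move=> f /(subsetP (ball_sub r eF)); exact: card_closed_nbr.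
by rewrite expnSr leq_mul2r IH orbT.
Qed.

(** By symmetry, if the ball of radius r + 1 around f contains z, then the ball of radius r around f
    meets the closed neighbourhood of z. *)
Lemma card_coball r z : z \in F ->
  (#|[set f in F | z \in ball adj F r f]| <= m.+1 ^ r)%N.
Proof.
move=> zF; elim: r z zF => [|r IH] z zF.
  apply: (@leq_trans #|[set z]|); last by rewrite cards1.
  by apply: subset_leq_card; apply/subsetP => f; rewrite !inE => /andP[_ /eqP ->].
apply: (@leq_trans #|\bigcup_(g in closed_nbr adj F z)
                       [set f in F | g \in ball adj F r f]|).
  apply: subset_leq_card; apply/subsetP => f.
  rewrite inE => /andP[fF /bigcupP[g gB zg]]; apply/bigcupP; exists g.
    have gF := subsetP (ball_sub r fF) _ gB.
    move: zg; rewrite !inE eq_sym adjC gF => /predU1P[->|/andP[_ ->]].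
      by rewrite eqxx.
    by rewrite orbT.
  by rewrite inE fF.
apply: leq_trans (card_bigcup_le (n := m.+1 ^ r) _) _.
  by move=> g /(subsetP (closed_nbr_sub zF)); exact: IH.
by rewrite expnS leq_mul2r card_closed_nbr ?orbT.
Qed.
End Balls.

Section CoveredLocal.
Variables (I T : finType) (X : local_space I T) (mu : T -> {set I}).

Lemma covered_local c (S : {set I}) e (w w' : power T c) :
  (forall t t', agree X S t t' -> (e \in mu t) = (e \in mu t')) ->
  agree (power_space X c) S w w' ->
  (e \in covered mu w) = (e \in covered mu w').
Proof.
move=> loc; elim: c w w' => [|c IH] w w' /=; first by rewrite !inE.
by case=> /loc e1 /IH e2; rewrite !in_setU e1 e2.
Qed.
End CoveredLocal.

(** * One round of colouring *)

Section Round.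
Variables (T I : finType) (ends : I -> {set T}).
Implicit Types F : {set I}.

Definition meets e f := (e != f) && (ends e :&: ends f != set0).
Definition star F x := [set e in F | x \in ends e].

Lemma meetsC : symmetric meets.
Proof. by move=> e f; rewrite /meets eq_sym setIC. Qed.

Lemma meetsxx : irreflexive meets.
Proof. by move=> e; rewrite /meets eqxx. Qed.

Section Bounded.
Variables (k D m : nat) (F : {set I}).
Hypotheses (kD : (k * D = m.+1)%N) (unif : forall e, e \in F -> #|ends e| = k).
Hypothesis deg : forall x, (#|star F x| <= D)%N.

(** Each of the k vertices of e lies in at most D - 1 other edges, and k (D - 1) <= kD - 1. *)
Lemma nbr_meets_le e : e \in F -> (#|nbr meets F e| <= m)%N.
Proof.
move=> eF; apply: (@leq_trans #|\bigcup_(x in ends e) (star F x :\ e)|).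
  apply/subset_leq_card/subsetP => f; rewrite inE /meets.
  case/and3P=> fF ef /set0Pn[x]; rewrite inE => /andP[xe xf].
  by apply/bigcupP; exists x => //; rewrite !inE eq_sym ef fF xf.
apply: leq_trans (card_bigcup_le (n := D.-1) _) _.
  move=> x xe; have := deg x.
  by rewrite (cardsD1 e) inE eF xe add1n; case: D => // D' ; rewrite ltnS.
rewrite unif //; move: kD; case: k => [//|k']; case: D => [|D' ]; lia.
Qed.

(** A dependent y is reached through an edge at x, an element z of its ball, an edge f whose ball
    contains z, and a vertex of f; this gives D (m+1)^r (m+1)^r k choices. *)
Lemma card_dependent r x :
  (#|[set y | ~~ [disjoint \bigcup_(e in star F x) ball meets F r e
                         & \bigcup_(e in star F y) ball meets F r e]]|
   <= m.+1 ^ (2 * r).+1)%N.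
Proof.
apply: (@leq_trans #|\bigcup_(e in star F x) \bigcup_(z in ball meets F r e)
    \bigcup_(f in [set f in F | z \in ball meets F r f]) ends f|).
  apply/subset_leq_card/subsetP => y; rewrite inE.
  case/pred0Pn=> z /andP[/bigcupP[e ex ze] /bigcupP[f]].
  rewrite inE => /andP[fF yf] zf.
  apply/bigcupP; exists e => //; apply/bigcupP; exists z => //.
  by apply/bigcupP; exists f => //; rewrite inE fF.
apply: leq_trans (card_bigcup_le (n := m.+1 ^ r * (m.+1 ^ r * k)) _) _.
  move=> e; rewrite inE => /andP[eF _].
  apply: leq_trans (card_bigcup_le (n := m.+1 ^ r * k) _) _; last first.
    by rewrite leq_mul2r card_ball ?orbT //; exact: nbr_meets_le.
  move=> z /(subsetP (ball_sub _ r eF)) zF.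
  apply: leq_trans (card_bigcup_le (n := k) _) _.
    by move=> f; rewrite inE => /andP[/unif -> _].
  by rewrite leq_mul2r (card_coball meetsC) ?orbT //; exact: nbr_meets_le.
apply: leq_trans (leq_mul (deg x) (leqnn _)) _.
rewrite expnS mul2n -addnn expnD; set a := (m.+1 ^ r)%N.
by rewrite -kD; apply: eq_leq; nia.
Qed.

(** The bad event at x is that more than z edges at x escape all c independent matchings. It depends
    on the balls of radius 2n around the edges at x; the local lemma avoids all bad events at
    once. *)
Lemma round_exists (R : realType) (n q L z c : nat) (Q W : R) :
  0 <= Q ->
  (forall e, e \in F ->
     Q <= prob R [pred w : power (power (step I m q) L) n | e \in staged meets F w]) ->
  1 <= W ->
  4 * (m.+1 ^ (2 * (2 * n)).+1)%:R
    * (W ^+ D * expR (- ((1 - W^-1) * (Q * z%:R))) ^+ c) <= W ^+ z ->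
  exists F1 : {set I}, [/\ F1 \subset F, colorable meets F1 c
    & forall x, (#|star (F :\: F1) x| <= z)%N].
Proof.
move=> Q0 probF W1 bound; have W0 : 0 < W := lt_le_trans ltr01 W1.
pose Om : finType := power (power (step I m q) L) n.
pose mu (w : Om) : {set I} := staged meets F w.
pose X := power_space (power_space (power_space (step_space I m q) L) n) c.
pose A x : pred (power Om c) := [pred w | z < #|star F x :\: covered mu w|]%N.
pose S x := \bigcup_(e in star F x) ball meets F (2 * n) e.
have Om0 : (0 < #|Om|)%N.
  by do 2 apply: card_power_gt0; rewrite card_ffun card_ord expn_gt0.
have E0 : 0 <= expR (- ((1 - W^-1) * (Q * z%:R))) ^+ c.
  by rewrite exprn_ge0 ?expR_ge0.
have [||x|x|x||w wP] := @lovasz_local_lemma R I _ X T A S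
    (m.+1 ^ (2 * (2 * n)).+1) (W ^+ D
       * expR (- ((1 - W^-1) * (Q * z%:R))) ^+ c / W ^+ z).
- exact: card_power_gt0.
- by rewrite expn_gt0.
- move=> w w' agr; rewrite /A /=; congr (_ < #|pred_of_set _|)%N.
  apply/setP => e; rewrite !in_setD.
  case: (boolP (e \in star F x)) => ex; last by rewrite !andbF.
  congr (~~ _ && _); apply: covered_local agr => t t'.
  apply: staged_local => //; exact: bigcup_sup.
- rewrite ler_pdivlMr ?exprn_gt0 // mulrC.
  have := @prob_uncovered R I Om mu (star F x) Q W z c.
  move=> h; apply: le_trans (h _ _ Q0 W1 Om0) _.
  (* Edges through x meet pairwise, so a matching contains at most one of them. *)
  + move=> t; apply/card_le1_eqP => e f.
    rewrite !inE => /andP[/andP[eF xe] et] /andP[/andP[fF xf] ft].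
    apply/eqP; apply: contraTT (staged_indep meetsC et ft) => ef.
    by rewrite negbK /meets eq_sym ef; apply/set0Pn; exists x; rewrite inE xe.
  + by move=> e; rewrite inE => /andP[/probF].
  + by rewrite ler_wpM2r // ler_weXn2l.
- exact: card_dependent.
- by rewrite mulrA ler_pdivrMr ?exprn_gt0 // mul1r.
exists (F :&: covered mu w); split; first exact: subsetIl.
  apply: colorable_sub (subsetIr _ _) _; apply: colorable_covered => t e f.
  exact: (staged_indep meetsC).
move=> x; rewrite leqNgt; apply: contra (wP x); rewrite /A /= => h.
apply: leq_trans h _; apply: subset_leq_card; apply/subsetP => e.
by rewrite !inE negb_and => /andP[/andP[/orP[/negbTE ->//|->] ->] ->].
Qed.
End Bounded.
End Round.

(** * Conclusion *)

Section LocalCountsAsSums.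
Variables (R : realType) (I : finType) (G : sgraph I).

Lemma leq_card_fibers (X Y : finType) (f : X -> Y) (P : {set X}) (E : {set Y}) c :
  (forall x, x \in P -> f x \in E) ->
  (forall x, x \in P -> (#|[set x' in P | f x' == f x]| <= c)%N) ->
  (#|P| <= c * #|E|)%N.
Proof.
move=> PE fib; rewrite -sum1_card (partition_big f [in E]) //= mulnC -sum_nat_const.
apply: leq_sum => y _.
case: (pickP [pred x in P | f x == y]) => [x /andP[xP /eqP <-]|none]; last first.
  by rewrite big_pred0.
rewrite sum1dep_card; apply: leq_trans (fib x xP); apply: subset_leq_card.
by apply/subsetP => x'; rewrite !inE.
Qed.

Lemma bin2_natr n : 2 * 'C(n, 2)%:R = n%:R * (n%:R - 1) :> R.
Proof.
elim: n => [|n IH]; first by rewrite bin0n mulr0 mul0r.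
by rewrite binS bin1 natrD mulrDr IH -natr1; ring.
Qed.

Lemma card_adj_pairs (S : {set I}) :
  (#|[set u : I * I | [&& u.1 \in S, u.2 \in S & adj G u.1 u.2]]|
   <= 2 * #|edges_within G S|)%N.
Proof.
apply: (leq_card_fibers (f := fun u : I * I => [set u.1; u.2])) => [[u w]|[u w]].
  by rewrite inE /= => /and3P[uS wS uw]; apply/imset2P; exists u w => //; rewrite inE wS.
rewrite inE /= => /and3P[uS wS uw].
apply: leq_trans (card_size [:: (u, w); (w, u)]).
apply/subset_leq_card/subsetP => -[x y]; rewrite !inE /=.
case/andP=> /and3P[_ _ xy] /eqP e.
have xny : x != y by apply: contraTneq xy => ->; rewrite adj_irr.
have : x \in [set u; w] by rewrite -e !inE eqxx.
have : y \in [set u; w] by rewrite -e !inE eqxx orbT.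
rewrite !inE !xpair_eqE => /orP[]/eqP yE /orP[]/eqP xE; subst x y;
  rewrite ?eqxx ?orbT //; by rewrite eqxx in xny.
Qed.

(** An upper bound is what is wanted, as $P$ enters $b$ with a minus sign; it holds since an edge
    comes from at most two ordered pairs. *)
Lemma P_le_sum v :
  P_ G R v <= (\sum_(u in nbhd G v) pairs_at R (adj G) (nbhd G v) u) / 2.
Proof.
rewrite /P_ /gdegree; set S := nbhd G v.
have := card_adj_pairs S.
have -> : \sum_(u in S) pairs_at R (adj G) S u
  = #|S|%:R * (#|S|%:R - 1)
    - #|[set u : I * I | [&& u.1 \in S, u.2 \in S & adj G u.1 u.2]]|%:R.
  have -> : #|[set u : I * I | [&& u.1 \in S, u.2 \in S & adj G u.1 u.2]]|%:R
     = \sum_(u in S) \sum_(w in S) (adj G u w)%:R :> R.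
    rewrite pair_big_dep /= -sum1_card natr_sum big_mkcond [RHS]big_mkcond /=.
    apply: eq_bigr => -[u w] _; rewrite inE /= andbA.
    by case: ((u \in S) && _) => //=; case: adj.
  have -> : #|S|%:R * (#|S|%:R - 1) = \sum_(u in S) (\sum_(w in S) (w != u)%:R) :> R.
    rewrite mulr_natl -sumr_const; apply: eq_bigr => u uS.
    rewrite (big_setD1 u) //= eqxx add0r (cardsD1 u S) uS natrD addrAC subrr add0r.
    rewrite -sum1_card natr_sum; apply: eq_bigr => w.
    by rewrite !inE => /andP[-> _].
  rewrite -sumrB; apply: eq_bigr => u uS; rewrite -sumrB; apply: eq_bigr => w wS.
  rewrite /nonadj eq_sym; case: eqVneq => [->|_] /=; first by rewrite adj_irr subrr.
  by case: adj; rewrite ?subrr ?subr0.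
rewrite -(ler_nat R) natrM.
rewrite -bin2_natr; lra.
Qed.

(** An independent set of size 3 has at most six orderings. *)
Lemma sum_le_T v :
  \sum_(u in nbhd G v) triples_at R (adj G) (nbhd G v) u <= 6 * T_ G R v.
Proof.
rewrite /T_ /nonadj_triples; move: (nbhd G v) => S.
pose na u w := (u != w) && ~~ adj G u w.
pose P := [set u : I * (I * I) | [&& u.1 \in S, u.2.1 \in S, u.2.2 \in S,
   na u.1 u.2.1, na u.1 u.2.2 & na u.2.1 u.2.2]].
have -> : \sum_(u in S) triples_at R (adj G) S u = #|P|%:R.
  rewrite /triples_at.
  rewrite (eq_bigr (fun u => \sum_(p : I * I | (p.1 \in S) && (p.2 \in S))
                       tri R (adj G) u p.1 p.2)); last first.
    by move=> u _; rewrite pair_big_dep.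
  rewrite pair_big_dep /= -sum1_card natr_sum big_mkcond [RHS]big_mkcond /=.
  apply: eq_bigr => -[u [w y]] _; rewrite !inE /tri /nonadj -!/(na _ _) /=.
  case: (u \in S); case: (w \in S); case: (y \in S) => //=.
  by case: (na u w); case: (na u y); case: (na w y); rewrite ?(mulr0, mul0r, mulr1).
rewrite -natrM ler_nat.
apply: (leq_card_fibers (f := fun u : I * (I * I) => [set u.1; u.2.1; u.2.2])).
  case=> u [w y]; rewrite !in_set /= => /and5P[uS wS yS /andP[uw uw']
    /andP[/andP[uy uy'] /andP[wy wy']]]; apply/and3P; split.
  - by rewrite !subUset !sub1set uS wS yS.
  - by rewrite setUC cardsU1 cards2 !inE uw negb_or ![y == _]eq_sym uy wy.
  - apply/forall_inP => a aB; apply/forall_inP => b bB.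
    by move: aB bB; rewrite !inE => /orP[/orP[]|]/eqP-> /orP[/orP[]|]/eqP->;
      rewrite ?adj_irr // adj_sym.
case=> u [w y]; rewrite inE /= => _.
apply: leq_trans (card_size [:: (u, (w, y)); (u, (y, w)); (w, (u, y));
                                (w, (y, u)); (y, (u, w)); (y, (w, u))]).
apply/subset_leq_card/subsetP => -[a [b d]]; rewrite !inE /=.
case/andP=> /and5P[_ _ _ /andP[ab _] /andP[/andP[ad _] /andP[bd _]]] /eqP e.
have : a \in [set u; w; y] by rewrite -e !inE eqxx.
have : b \in [set u; w; y] by rewrite -e !inE eqxx orbT.
have : d \in [set u; w; y] by rewrite -e !inE eqxx orbT.
rewrite !inE !xpair_eqE.
move=> /orP[/orP[]|]/eqP dE /orP[/orP[]|]/eqP bE /orP[/orP[]|]/eqP aE;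
  subst a b d; rewrite ?eqxx ?orbT //; by rewrite ?eqxx in ab ad bd.
Qed.

Lemma pot_le_b (M : R) v : 0 < M -> pot (adj G) M (nbhd G v) <= b_ G M v.
Proof.
move=> M0; have MV n : 0 <= (M ^+ n)^-1 by rewrite invr_ge0 exprn_ge0 // ltW.
rewrite /pot /b_ /gdegree; apply: lerD.
  rewrite lerD2l lerN2 [leRHS](_ : _ = (\sum_(u in nbhd G v)
    pairs_at R (adj G) (nbhd G v) u) / 2 / M ^+ 2); last by rewrite invfM mulrA.
  exact: (ler_wpM2r (MV 2) (P_le_sum v)).
rewrite [leLHS](_ : _ = (\sum_(u in nbhd G v)
    triples_at R (adj G) (nbhd G v) u) / 6 / M ^+ 3); last by rewrite invfM mulrA.
by apply: (ler_wpM2r (MV 3)); rewrite ler_pdivrMr // mulrC sum_le_T.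
Qed.
End LocalCountsAsSums.

Lemma eq_pot (R : realFieldType) (I : finType) (adj adj' : rel I) (M : R)
    (A : {set I}) :
  {in A &, adj =2 adj'} -> pot adj M A = pot adj' M A.
Proof.
move=> eqA.
have eqN u w : u \in A -> w \in A -> nonadj R adj u w = nonadj R adj' u w.
  by move=> uA wA; rewrite /nonadj eqA.
congr (_ - _ / _ + _ / _); apply: eq_bigr => u uA.
  by apply: eq_bigr => w wA; exact: eqN.
apply: eq_bigr => w wA; apply: eq_bigr => y yA.
by rewrite /tri !eqN.
Qed.

(** With a = c / (N + 1), the exponential is the (N + 1)-st power of exp(aD), which is at least
    aD. *)
Lemma expR_beats_power (R : realType) (c K : R) (N : nat) : 0 < c ->
  exists D0 : nat, forall D, (D0 <= D)%N -> K * D%:R ^+ N <= expR (c * D%:R).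
Proof.
move=> c0; pose a := c / N.+1%:R.
have a0 : 0 < a by rewrite divr_gt0.
have aN : 0 < a ^+ N.+1 by rewrite exprn_gt0.
exists (Num.bound (`|K| / a ^+ N.+1)) => D DD.
have KD : K <= a ^+ N.+1 * D%:R.
  rewrite mulrC -ler_pdivrMr //; apply: le_trans (_ : `|K| / a ^+ N.+1 <= _).
    by rewrite ler_wpM2r ?ler_norm // invr_ge0 ltW.
  apply: le_trans (ltW (archi_boundP _)) _; last by rewrite ler_nat.
  by rewrite divr_ge0 // ltW.
have -> : c * D%:R = N.+1%:R * (a * D%:R).
  by rewrite mulrA [_ * a]mulrC divfK // pnatr_eq0.
rewrite expRM_natl; apply: (@le_trans _ _ ((a * D%:R) ^+ N.+1)).
  by rewrite exprMn [D%:R ^+ N.+1]exprS mulrA ler_wpM2r ?exprn_ge0.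
have aD : 0 <= a * D%:R by apply: mulr_ge0 => //; exact: ltW.
rewrite lerXn2r ?nnegrE ?expR_ge0 //.
by apply: (le_trans _ (expR_ge1Dx _)); rewrite lerDr.
Qed.

(** The parameters of a round: the degree falls by t, about [th * D], and each unit costs about (b +
    th) k colours. [N0] depends on [th] and [k] alone, so rounds can be iterated. *)
Lemma round_step (R : realType) (th : R) (k : nat) :
  0 < th -> 16 * th <= 1 -> (0 < k)%N ->
  exists N0 : nat, forall D, (N0 <= D)%N ->
  forall (T I : finType) (ends : I -> {set T}) (F : {set I}) (b : R),
  0 < b -> b + th <= 1 ->
  (forall e, e \in F -> #|ends e| = k) ->
  (forall x, (#|star ends F x| <= D)%N) ->
  (forall (U : {set I}) e, U \subset F -> e \in U ->
     pot (meets ends) (k%:R * D%:R) (nbr (meets ends) U e) <= b) ->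
  exists z c (F1 : {set I}), [/\ (z < D)%N, F1 \subset F,
    colorable (meets ends) F1 c,
    forall x, (#|star ends (F :\: F1) x| <= z)%N
    & c%:R <= (1 + 8 * th) * (b + th) * k%:R * (D - z)%:R].
Proof.
move=> th0 th16 k0.
have [|||n nP] := @staged_prob_ge R th th; [by []|by lra|by []|].
(* The polynomial is the dependency bound of the local lemma times 4; it must lose against the tail
   bound exp(- th^3 D / 16). *)
have [N1 N1P] := @expR_beats_power R (th ^+ 3 / 16)
  (4 * k%:R ^+ (2 * (2 * n)).+1) (2 * (2 * n)).+1
  (divr_gt0 (exprn_gt0 3 th0) (ltr0n _ 16)).
pose N2 := Num.bound (4 / th ^+ 3).
exists (N1 + N2)%N => D DN T I ends F b b0 bth unif deg potF.
have {}N1P := N1P D (leq_trans (leq_addr _ _) DN).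
have th3 : 0 < th ^+ 3 by rewrite exprn_gt0.
have DthR : 4 < th ^+ 3 * D%:R.
  rewrite mulrC -ltr_pdivrMr //; apply: lt_le_trans (archi_boundP _) _.
    by rewrite divr_ge0 // ltW.
  by rewrite ler_nat (leq_trans (leq_addl _ _) DN).
have k1 : 1 <= k%:R :> R by rewrite ler1n.
have D0 : 0 <= D%:R :> R by [].
have thD : 4 <= th * D%:R.
  have : th ^+ 3 <= th by rewrite -[leRHS]expr1 ler_wiXn2l // ltW //; lra.
  nra.
have Dpos : (0 < D)%N by rewrite -(ltr0n R); nra.
have kDpos : (0 < k * D)%N by rewrite muln_gt0 k0.
pose m := (k * D).-1; have kD : (k * D = m.+1)%N by rewrite prednK.
have MR : m.+1%:R = k%:R * D%:R :> R by rewrite -kD natrM.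
have M0 : 0 < m.+1%:R :> R by rewrite ltr0n.
have be0 : 0 < b + th by rewrite addr_gt0.
have DM : D%:R <= m.+1%:R :> R by rewrite MR; nra.
have thM : 4 <= th * m.+1%:R by apply: le_trans thD _; rewrite ler_wpM2l // ltW.
have degm := nbr_meets_le kD unif deg.
have [|||q [L probF]] :=
  nP I (meets ends) (meetsC ends) (meetsxx ends) m F (b + th) thM degm.
- by rewrite lerDr ltW.
- by [].
- move=> U e UF eU; apply: lerD; first by rewrite MR; exact: potF.
  rewrite ler_pdivrMr //; lra.
pose t := Num.truncn (th * D%:R).
have /andP[tle tgt] : t%:R <= th * D%:R < t.+1%:R.
  by apply: Num.Theory.truncn_itv; lra.
rewrite -natr1 in tgt.
have tge : th * D%:R <= 2 * t%:R by lra.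
have tt : 1 <= th ^+ 2 * t%:R.
  have : th ^+ 2 * (th * D%:R) <= th ^+ 2 * (2 * t%:R).
    by rewrite ler_wpM2l // exprn_ge0 // ltW.
  have -> : th ^+ 2 * (th * D%:R) = th ^+ 3 * D%:R by ring.
  lra.
have tD : (t <= D)%N.
  by rewrite -(ler_nat R); apply: le_trans tle _; rewrite ler_piMl //; lra.
have t0 : (0 < t)%N by rewrite -(ltr0n R); lra.
pose z := (D - t)%N.
have zR : z%:R = D%:R - t%:R :> R by rewrite natrB.
have zge : (1 - th) * D%:R <= z%:R by rewrite zR; lra.
(* A lower bound for Q z, hence for the mean number of edges that a matching takes at a vertex with
   z uncovered edges. *)
pose s := (1 - th) ^+ 2 / ((b + th) * k%:R).
have be_k : 0 < (b + th) * k%:R by rewrite mulr_gt0 // ltr0n.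
have s0 : 0 < s by rewrite divr_gt0 // exprn_gt0 //; lra.
pose Q := (1 - th) / ((b + th) * m.+1%:R).
have Q0 : 0 <= Q by rewrite divr_ge0 ?mulr_ge0 ?(ltW be0) //; lra.
have Qz : s <= Q * z%:R.
  have DR0 : 0 < D%:R :> R by rewrite ltr0n.
  have -> : s = Q * ((1 - th) * D%:R).
    rewrite /s /Q MR; field.
    by rewrite !gt_eqF ?ltr0n.
  by rewrite ler_wpM2l.
pose x := (1 + th) * t%:R / s.
(* Rounded up, so that c s >= (1 + th) t; the factor 1 + th leaves room for the tail bound. *)
pose c := (Num.truncn x).+1.
have x0 : 0 <= x by rewrite divr_ge0 ?(ltW s0) // mulr_ge0 //; lra.
have /andP[cle cge] := Num.Theory.truncn_itv x0.
have cs : (1 + th) * t%:R <= c%:R * s by rewrite -ler_pdivrMr // ltW.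
(* As W <= exp(th / 2), the exponent to control is t th/2 - c g Q z <= - (th/2 - g) t, and g = th /
   (2 + th) lies at least th^2 / 8 below th/2. *)
pose W := 1 + th / 2.
have W1 : 1 <= W by rewrite lerDl; lra.
have W0 : 0 < W by lra.
pose g := 1 - W^-1.
have gE : g * (2 + th) = th by rewrite /g /W; field; lra.
have g0 : 0 <= g by rewrite subr_ge0 invf_le1.
have bound : 4 * (m.+1 ^ (2 * (2 * n)).+1)%:R
    * (W ^+ D * expR (- (g * (Q * z%:R))) ^+ c) <= W ^+ z.
  set y := g * (Q * z%:R); set K := 4 * _.
  have gle : g <= th / 2 - th ^+ 2 / 8.
    rewrite -subr_ge0 -(pmulr_lge0 _ (_ : 0 < 2 + th)); last by lra.
    have -> : (th / 2 - th ^+ 2 / 8 - g) * (2 + th)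
            = th ^+ 2 / 8 * (2 - th) + (th - g * (2 + th)) by field.
    by rewrite gE subrr addr0 mulr_ge0 ?divr_ge0 ?exprn_ge0 ?(ltW th0) //; lra.
  have cy : (th - g) * t%:R <= c%:R * y.
    have h1 : g * ((1 + th) * t%:R) <= g * (c%:R * s) by rewrite ler_wpM2l.
    have h2 : g * (c%:R * s) <= g * (c%:R * (Q * z%:R)) by rewrite !ler_wpM2l.
    have -> : th - g = g * (1 + th) by rewrite -[in LHS]gE; ring.
    by rewrite -mulrA /y [leRHS]mulrCA; exact: le_trans h1 h2.
  have expo : t%:R * (th / 2) + c%:R * - y <= - (th ^+ 3 / 16 * D%:R).
    have h1 : (th ^+ 2 / 8) * t%:R <= (th / 2 - g) * t%:R by rewrite ler_wpM2r //; lra.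
    have h2 : th ^+ 2 * (th * D%:R) <= th ^+ 2 * (2 * t%:R).
      by rewrite ler_wpM2l // exprn_ge0 // ltW.
    have h3 : th ^+ 3 / 16 * D%:R = th ^+ 2 * (th * D%:R) / 16 by field.
    rewrite h3; move: h1 h2 cy; rewrite mulrN.
    by move: (th ^+ 2 * (th * D%:R)) (c%:R * y) => a1 a2; lra.
  have Wt : W ^+ t * expR (- y) ^+ c <= expR (- (th ^+ 3 / 16 * D%:R)).
    apply: (@le_trans _ _ (expR (t%:R * (th / 2)) * expR (c%:R * - y))).
      rewrite !expRM_natl ler_wpM2r ?exprn_ge0 ?expR_ge0 //.
      by rewrite lerXn2r ?nnegrE ?expR_ge0 ?(ltW W0) // expR_ge1Dx.
    by rewrite -expRD ler_expR.
  have KE : K <= expR (th ^+ 3 / 16 * D%:R).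
    by rewrite /K natrX MR exprMn mulrA.
  (* Since W^D = W^z W^t, the remaining factor has to be at most 1. *)
  have -> : K * (W ^+ D * expR (- y) ^+ c) = W ^+ z * (K * (W ^+ t * expR (- y) ^+ c)).
    rewrite -[in W ^+ D](subnK tD) -/z exprD; ring.
  rewrite ler_piMr ?exprn_ge0 ?(ltW W0) //.
  apply: (@le_trans _ _ (expR (th ^+ 3 / 16 * D%:R) * expR (- (th ^+ 3 / 16 * D%:R)))).
    have K0 : 0 <= K by rewrite mulr_ge0.
    by rewrite ler_pM // mulr_ge0 ?exprn_ge0 ?expR_ge0 // ltW.
  by rewrite expRN mulfV // lt0r_neq0 // expR_gt0.
have [F1 [F1F colF1 degF1]] := round_exists kD unif deg Q0 probF W1 bound.
exists z, c, F1; split=> //.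
  by rewrite /z ltn_subrL t0.
rewrite /z subKn // /c -natr1.
(* 1 + 7 th absorbs (1 + th) / (1 - th)^2; one further [th] will absorb the rounding of c. *)
have xle : x <= (1 + 7 * th) * ((b + th) * k%:R) * t%:R.
  rewrite /x /s invf_div [leLHS]mulrA ler_pdivrMr ?exprn_gt0 //; last by lra.
  have : (1 + th) <= (1 + 7 * th) * (1 - th) ^+ 2 by nra.
  have : 0 <= (b + th) * k%:R * t%:R by rewrite mulr_ge0 // ltW.
  move: ((b + th) * k%:R) (t%:R) => y t'; nra.
have : 1 <= th * ((b + th) * k%:R) * t%:R.
  apply: le_trans tt _; rewrite expr2 ler_wpM2r // ler_wpM2l ?(ltW th0) //.
  nra.
move: cle; lra.
Qed.

Lemma colorable_kD (T I : finType) (ends : I -> {set T}) (k D : nat) (F : {set I}) :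
  (0 < k)%N -> (forall e, e \in F -> #|ends e| = k) ->
  (forall x, (#|star ends F x| <= D)%N) -> colorable (meets ends) F (k * D).
Proof.
move=> k0 unif deg.
apply: (colorable_greedy (meetsC ends) (meetsxx ends)) => e eF.
have /card_gt0P[x xe] : (0 < #|ends e|)%N by rewrite unif.
have D0 : (0 < D)%N.
  by apply: leq_trans (deg x); apply/card_gt0P; exists e; rewrite inE eF.
have kD : (k * D = (k * D).-1.+1)%N by rewrite prednK // muln_gt0 k0.
by rewrite kD ltnS; exact: (nbr_meets_le kD unif deg eF).
Qed.

(** Strong induction on the degree bound D. The hypothesis covers every D >= d, since the
    intermediate degrees are not prescribed; below d the greedy colouring costs at most k d. *)
Lemma colorable_rounds (R : realType) (th : R) (k : nat) :
  0 < th -> 16 * th <= 1 -> (0 < k)%N ->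
  exists N0 : nat, forall (T I : finType) (ends : I -> {set T}) (F0 : {set I})
    (b d : R), N0%:R <= d -> 0 < b -> b + th <= 1 ->
  (forall e, e \in F0 -> #|ends e| = k) ->
  (forall D : nat, d <= D%:R -> forall U : {set I}, U \subset F0 ->
     (forall x, (#|star ends U x| <= D)%N) -> forall e, e \in U ->
     pot (meets ends) (k%:R * D%:R) (nbr (meets ends) U e) <= b) ->
  forall D (F : {set I}), F \subset F0 ->
  (forall x, (#|star ends F x| <= D)%N) ->
  exists C, colorable (meets ends) F C
    /\ C%:R <= (1 + 8 * th) * (b + th) * k%:R * D%:R + k%:R * d.
Proof.
move=> th0 th16 k0; have [N0 N0P] := round_step th0 th16 k0; exists N0.
move=> T I ends F0 b d Nd b0 bth unif potU; elim/ltn_ind => D IH F FF0 deg.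
have c0 : 0 <= (1 + 8 * th) * (b + th) * k%:R by rewrite !mulr_ge0 //; lra.
have unifF e : e \in F -> #|ends e| = k by move/(subsetP FF0); exact: unif.
have [Dd|dD] := ltrP D%:R d.
  exists (k * D)%N; split; first exact: colorable_kD.
  rewrite natrM; apply: (@le_trans _ _ (k%:R * d)); first by rewrite ler_wpM2l // ltW.
  by rewrite lerDr; exact: mulr_ge0.
have ND : (N0 <= D)%N by rewrite -(ler_nat R) (le_trans Nd).
have [|z [c [F1 [zD F1F col1 deg1 cle]]]] :=
  N0P D ND T I ends F b b0 bth unifF deg.
  move=> U e UF eU; apply: potU => //; first exact: subset_trans UF FF0.
  move=> x; apply: leq_trans (deg x); apply: subset_leq_card.
  by apply/subsetP => f; rewrite !inE => /andP[/(subsetP UF) -> ->].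
have [|C [colC Cle]] := IH z zD (F :\: F1) _ deg1.
  by apply: subset_trans FF0; exact: subsetDl.
exists (c + C)%N; split.
  rewrite -(setID F F1) (setIidPr F1F); exact: colorableU.
rewrite natrD; move: cle; rewrite natrB ?(ltnW zD) // => cle.
by move: Cle cle; move: (_ * k%:R) => a; lra.
Qed.

(** * Translation to hypergraphs *)

Section Hypergraph.
Variables (T I : finType) (HH : hypergraph T I).

Lemma star_le_max_hdegree x :
  (#|star (ends HH) (hedges HH) x| <= max_hdegree HH)%N.
Proof.
have [xV|xV] := boolP (x \in hverts HH).
  by rewrite -[#|_|]/(hdegree HH x) /max_hdegree; exact: leq_bigmax_cond.
(* The maximum runs over [hverts] only, but vertices outside lie in no edge. *)
apply: leq_trans (_ : 0 <= _)%N => //; rewrite leqn0 cards_eq0; apply/eqP/setP => e.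
rewrite !inE; apply: contraNF xV => /andP[eH]; exact: (subsetP (ends_sub eH)).
Qed.

Lemma chromatic_index_le n :
  colorable (meets (ends HH)) (hedges HH) n -> (chromatic_index HH <= n)%N.
Proof.
case=> c [cn cH]; rewrite /chromatic_index; case: ex_minnP => i _; apply.
apply/existsP; exists [ffun e => Ordinal (cn (val e) (valP e))].
apply/forallP => e; apply/forallP => f; apply/implyP => /andP[ef int].
rewrite !ffunE -val_eqE /=; apply/eqP; apply: cH; rewrite ?(valP e) ?(valP f) //.
by rewrite /meets (inj_eq val_inj) ef.
Qed.

Lemma edge_subset_ends (U : {set I}) : U \subset hedges HH ->
  forall e, e \in U -> ends HH e \subset hverts HH.
Proof. by move=> /subsetP UH e /UH; exact: ends_sub. Qed.

Definition edge_subhypergraph (U : {set I}) (UH : U \subset hedges HH) :=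
  Hypergraph (edge_subset_ends UH).

Lemma edge_subhypergraphP (U : {set I}) (UH : U \subset hedges HH) :
  subhypergraph (edge_subhypergraph UH) HH.
Proof. by rewrite /subhypergraph subxx UH; apply/forall_inP. Qed.

Lemma pot_meets_le_b (R : realType) (U : {set I}) (UH : U \subset hedges HH) (M : R) e :
  0 < M -> e \in U ->
  pot (meets (ends HH)) M (nbr (meets (ends HH)) U e)
    <= b_ (line_graph (edge_subhypergraph UH)) M e.
Proof.
move=> M0 eU; apply: le_trans (pot_le_b _ _ M0).
have -> : nbhd (line_graph (edge_subhypergraph UH)) e = nbr (meets (ends HH)) U e.
  apply/setP => f; rewrite !inE /= /line_adj /= eU /=.
  by case: (f \in U).
rewrite (@eq_pot _ _ _ (adj (line_graph (edge_subhypergraph UH)))) // => f g.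
by rewrite !inE /= /line_adj /= => /andP[-> _] /andP[-> _].
Qed.
End Hypergraph.

Theorem theorem1p5 (R : realType) (eps : R) (k : nat)
    (eps_gt0 : 0 < eps) (k_gt0 : (0 < k)%N) :
  exists D0 : R, forall D : R, D0 <= D ->
  forall b : R, 0 < b -> b < 1 ->
  forall (T I : finType) (HH : hypergraph T I),
    uniform k HH ->
    (max_hdegree HH)%:R <= D ->
    (forall D' : R, eps * D / 3 <= D' ->
     forall H : hypergraph T I, subhypergraph H HH ->
       (max_hdegree H)%:R <= D' ->
       forall e : I, e \in hedges H ->
         b_ (line_graph H) (k%:R * D') e <= b) ->
    (chromatic_index HH)%:R <= (b + eps) * k%:R * D.
Proof.
(* The minimum with 1 secures 16 th <= 1 for the rounds even when [eps] is large. *)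
pose th := Num.min eps 1 / 16.
have m0 : 0 < Num.min eps 1 by rewrite lt_min eps_gt0 ltr01.
have m1 : Num.min eps 1 <= 1 by rewrite ge_min lexx orbT.
have me : Num.min eps 1 <= eps by rewrite ge_min lexx.
have th0 : 0 < th by rewrite divr_gt0.
have th16 : 16 * th <= 1 by rewrite /th; lra.
have the : 16 * th <= eps by rewrite /th; lra.
have [N0 N0P] := colorable_rounds th0 th16 k_gt0.
(* Makes the threshold eps D / 3 positive and at least the [N0] of the rounds. *)
exists (3 * N0.+1%:R / eps) => D DD b b0 b1 T I HH /forall_inP unif maxD hyp.
have k0 : 0 < k%:R :> R by rewrite ltr0n.
have dN : N0.+1%:R <= eps * D / 3.
  by move: DD; rewrite ler_pdivrMr // ler_pdivlMr //; lra.
have D0 : 0 < D.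
  have : 0 < N0.+1%:R :> R by rewrite ltr0n.
  by move: dN; move: (N0.+1%:R) => x; nra.
have unifH e : e \in hedges HH -> #|ends HH e| = k by move/unif/eqP.
have degH := star_le_max_hdegree HH.
have kM : k%:R * (max_hdegree HH)%:R <= k%:R * D by rewrite ler_wpM2l // ltW.
(* If b + eps >= 1 the greedy bound kD suffices; otherwise b + th <= 1, as the rounds require. *)
have [be|be] := leP 1 (b + eps).
  have := chromatic_index_le (colorable_kD k_gt0 unifH degH).
  rewrite -(ler_nat R) natrM => h; apply: le_trans h _; apply: le_trans kM _.
  by rewrite -mulrA ler_peMl // mulr_ge0 // ltW.
have [|||C [colC Cle]] := N0P T I (ends HH) (hedges HH) b (eps * D / 3) _ b0 _ unifH
    _ (max_hdegree HH) (hedges HH) (subxx _) degH.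
- by apply: le_trans dN; rewrite ler_nat.
- lra.
- move=> D' dD' U UH degU e eU.
  have D'0 : 0 < D'%:R :> R.
    by apply: lt_le_trans dD'; apply: lt_le_trans dN; rewrite ltr0n.
  apply: le_trans (pot_meets_le_b UH (mulr_gt0 k0 D'0) eU) _.
  apply: (hyp D'%:R dD' _ (edge_subhypergraphP UH)) => //.
  by rewrite ler_nat; apply/bigmax_leqP => x _; exact: degU.
have := chromatic_index_le colC; rewrite -(ler_nat R) => h; apply: le_trans h _.
apply: le_trans Cle _.
have c0 : 0 <= (1 + 8 * th) * (b + th) by rewrite mulr_ge0 //; lra.
have kD0 : 0 <= k%:R * D by rewrite mulr_ge0 // ltW.
(* As b < 1, the excess is at most 9 th + 8 th^2, below 2 eps / 3; the last third of [eps] pays for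
   the greedy colouring below eps D / 3. *)
have h1 : (1 + 8 * th) * (b + th) <= b + 2 * eps / 3 by nra.
have h2 := ler_wpM2l c0 kM.
have h3 := ler_wpM2r kD0 h1.
rewrite -mulrA.
apply: le_trans (_ : (1 + 8 * th) * (b + th) * (k%:R * D)
                     + k%:R * (eps * D / 3) <= _); first by rewrite lerD2r.
apply: le_trans (_ : (b + 2 * eps / 3) * (k%:R * D)
                     + k%:R * (eps * D / 3) <= _); first by rewrite lerD2r.
lra.
Qed.
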